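(* Let $\Gamma\cong\mathbb{Z}/2\mathbb{Z}$ be the group generated by a reflection of $\mathbb{R}^2$ through a line through the origin, and let $(\tilde G,\varphi)$ be a finite graph with a $\Gamma$-action $\varphi$ that is free on vertices and edges, with associated colored quotient graph $(G,\boldsymbol\gamma)$ on $n$ vertices. Then a generic reflection framework on $(\tilde G,\varphi)$ is minimally rigid if and only if $(G,\boldsymbol\gamma)$ is reflection-Laman. That is, there is a proper algebraic subset $Z\subset\mathbb{R}^{2n}$ such that for every $\mathbf p=(\mathbf p_i)_{i\in V(G)}\in\mathbb{R}^{2n}\setminus Z$, the symmetric realization $\tilde G(\mathbf p)$ determined by $\mathbf p$ (with the edge lengths it induces) is minimally rigid if and only if $(G,\boldsymbol\gamma)$ is reflection-Laman.
   Context: Graphs are finite nonempty multigraphs. A $\Gamma$-framework is a triple $(\tilde G,\varphi,\tilde{\boldsymbol\ell})$, where $\tilde G$ is a finite graph, $\varphi$ is a $\Gamma$-action on $\tilde G$ that is free on vertices and on edges, and $\tilde{\boldsymbol\ell}=(\ell_{ij})_{ij\in E(\tilde G)}$ is a vector of positive edge lengths (in particular $\tilde G$ has no self-loops). When $\Gamma$ is generated by a reflection it is called a reflection framework. A realization $\tilde G(\mathbf p)$ is an assignment of points $\mathbf p_i\in\mathbb{R}^2$ to $i\in V(\tilde G)$ such that $\|\mathbf p_j-\mathbf p_i\|^2=\ell_{ij}^2$ for all $ij\in E(\tilde G)$ and $\mathbf p_{\varphi(\gamma)\cdot i}=\gamma\cdot\mathbf p_i$ for all $\gamma\in\Gamma$,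 $i\in V(\tilde G)$. Let $\mathcal R(\tilde G,\varphi,\tilde{\boldsymbol\ell})$ be the space of all realizations; the configuration space is $\mathcal R(\tilde G,\varphi,\tilde{\boldsymbol\ell})/\mathrm{Cent}(\Gamma)$, where $\mathrm{Cent}(\Gamma)$ is the centralizer of $\Gamma$ in the group $\mathrm{Euc}(2)$ of isometries of $\mathbb{R}^2$. A realization is rigid if it is isolated in the configuration space, and minimally rigid if it is rigid but ceases to be so after removing any $\Gamma$-orbit of edges from $\tilde G$. Colored quotient. Identify $\Gamma$ with $\mathbb{Z}/2\mathbb{Z}$. A colored graph $(G,\boldsymbol\gamma)$ is a finite directed graph $G$ with a color $\gamma_{ij}\in\mathbb{Z}/2\mathbb{Z}$ on each edge $ij$. The colored quotient of $(\tilde G,\varphi)$ has $G=\tilde G/\Gamma$: choose a representative $\tilde i_0$ in each vertex orbit $i$ and put $\tilde i_\gamma=\varphi(\gamma)\cdot\tilde i_0$; orient each edge orbit $ij$, and let $\gamma_{ij}$ be the color such that the orbit consists of the edges $\tilde i_\gamma\tilde j_{\gamma+\gamma_{ij}}$, $\gamma\in\mathbb{Z}/2\mathbb{Z}$. A point $\mathbf p=(\mathbf p_i)_{i\in V(G)}\in\mathbb{R}^{2n}$ determines a symmetric placement by $\mathbf p_{\tilde i_\gamma}=\gamma\cdot\mathbf p_i$. The map $\rho:H_1(G,\mathbb{Z})\to\mathbb{Z}/2\mathbb{Z}$ is the homomorphism defined on oriented cycles by adding up the colors of the traversed edges, with a minus sign for edges traversed in reverse. A subgraph has trivial $\rho$-image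 if $\rho$ vanishes on all its cycles. $(G,\boldsymbol\gamma)$ with $n$ vertices and $m$ edges is reflection-Laman if $m=2n-1$ and every subgraph $G'$ spanned by a nonempty set of edges, with $n'$ vertices, $m'$ edges, $c'$ connected components with non-trivial $\rho$-image and $c_0'$ connected components with trivial $\rho$-image, satisfies $m'\le 2n'-c'-3c_0'$. *)

(* Defs.v *)
From HB Require Import structures.
From mathcomp Require Import all_boot all_order all_algebra all_fingroup.
From mathcomp Require Import generic_quotient.
From mathcomp Require Import boolp classical_sets functions reals topology normedtype.
From mathcomp Require mpoly.

Set Implicit Arguments.
Unset Strict Implicit.
Unset Printing Implicit Defensive.
Import Order.TTheory GRing.Theory Num.Theory.
Import numFieldNormedType.Exports.
Local Open Scope ring_scope.

(* An undirected multigraph: an edge is an abstract object together with the   *)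
(* set of its two (distinct) endpoints, so parallel edges are allowed.         *)
Record multigraph := Multigraph {
  vert : finType;
  edge : finType;
  ends : edge -> {set vert};
  vert_gt0 : (0 < #|vert|)%N;
  loopless : forall e, #|ends e| = 2%N }.

(* The reflection group is identified with 'Z_2, 0 being the identity and 1    *)
(* the reflection; phi(g).i is written [vact phi i g].  An edge may join i to  *)
(* phi(1).i: being free on edges then forces a second, parallel, edge.         *)
Record free_action (G : multigraph) := FreeAction {
  vact : {action 'Z_2 &-> vert G};
  eact : {action 'Z_2 &-> edge G};
  ends_act : forall e g, ends (eact e g) = [set vact v g | v in ends e]%SET;
  vact_free : forall v g, vact v g = v -> g = 0;
  eact_free : forall e g, eact e g = e -> g = 0 }.

Record colored_graph := ColoredGraph {
  cvert : finType;
  cedge : finType;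
  src : cedge -> cvert;
  tgt : cedge -> cvert;
  color : cedge -> 'Z_2 }.

Section Orbits.
Variables (T : finType) (to : {action 'Z_2 &-> T}).

Definition orbits : {set {set T}} :=
  [set orbit to [set: 'Z_2] x | x : T]%SET.

Definition orbit_type : finType := {o : {set T} | o \in orbits}.

Lemma orbit_in_orbits (x : T) : orbit to [set: 'Z_2]%SET x \in orbits.
Proof. exact: imset_f. Qed.

Definition orbit_of (x : T) : orbit_type :=
  exist (fun o => o \in orbits) _ (orbit_in_orbits x).

Lemma orbit_of_eq (o : orbit_type) (x : T) : x \in val o -> orbit_of x = o.
Proof.
case: o => o /= oP xo; apply/val_inj => /=.
by case/imsetP: oP xo => y _ -> /orbit_in_eqP ->.
Qed.

End Orbits.

(* All the choices entering the construction of a colored quotient: orbit      *)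
(* representatives, and an orientation and color of each edge orbit f, so that *)
(* f consists of the edges e_g joining (src f)_g to (tgt f)_(g + color f).     *)
Record colored_quotient (G : multigraph) (phi : free_action G) :=
  ColoredQuotient {
  rep : orbit_type (vact phi) -> vert G;
  rep_mem : forall w, rep w \in val w;
  qsrc : orbit_type (eact phi) -> orbit_type (vact phi);
  qtgt : orbit_type (eact phi) -> orbit_type (vact phi);
  qcolor : orbit_type (eact phi) -> 'Z_2;
  quotientP : forall f : orbit_type (eact phi),
    exists2 e, e \in val f & forall g : 'Z_2,
      ends (eact phi e g) =
      [set vact phi (rep (qsrc f)) g;
           vact phi (rep (qtgt f)) (g + qcolor f)]%SET }.

Definition quotient_graph (G : multigraph) (phi : free_action G)
    (Q : colored_quotient phi) : colored_graph :=
  ColoredGraph (qsrc Q) (qtgt Q) (qcolor Q).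

Section ReflectionLaman.
Variable H : colored_graph.
Implicit Types (A : {set cedge H}) (c : seq (cedge H * bool)).

(* (f, true) is f traversed from src to tgt, (f, false) is f in reverse.       *)
Definition step_from (s : cedge H * bool) := if s.2 then src s.1 else tgt s.1.
Definition step_to (s : cedge H * bool) := if s.2 then tgt s.1 else src s.1.

Definition oriented_cycle A c :=
  [&& all (fun s => s.1 \in A) c,
      path.cycle (fun s t => step_to s == step_from t) c,
      uniq [seq step_from s | s <- c] & uniq [seq s.1 | s <- c]].

Definition rho c : 'Z_2 :=
  \sum_(s <- c) (if s.2 then color s.1 else - color s.1).

Definition trivial_image A := forall c, oriented_cycle A c -> rho c = 0.

Definition spanned_verts A : {set cvert H} :=
  [set v | [exists f in A, (v == src f) || (v == tgt f)]]%SET.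

Definition adjacent A (v w : cvert H) :=
  [exists f in A, ((src f == v) && (tgt f == w))
               || ((src f == w) && (tgt f == v))].

Definition components A : {set {set cvert H}} :=
  equivalence_partition (connect (adjacent A)) (spanned_verts A).

Definition component_edges A (C : {set cvert H}) : {set cedge H} :=
  [set f in A | src f \in C]%SET.

Definition nontrivial_components A : {set {set cvert H}} :=
  [set C in components A | ~~ `[< trivial_image (component_edges A C) >]]%SET.

Definition trivial_components A : {set {set cvert H}} :=
  [set C in components A | `[< trivial_image (component_edges A C) >]]%SET.

Definition reflection_laman :=
  #|cedge H|%:Z = 2 * #|cvert H|%:Z - 1 /\
  forall A, (0 < #|A|)%N ->
    #|A|%:Z <= 2 * #|spanned_verts A|%:Z - #|nontrivial_components A|%:Z
               - 3 * #|trivial_components A|%:Z.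

End ReflectionLaman.

Local Open Scope classical_set_scope.

Section Plane.
Variable R : realType.
Implicit Types x y : 'rV[R]_2.

Definition dot x y : R := \sum_k x ord0 k * y ord0 k.

(* The library norm on 'rV[R]_2 is the max norm, hence this Euclidean one.     *)
Definition enorm x : R := Num.sqrt (dot x x).

Definition Euc2 : set ('rV[R]_2 -> 'rV[R]_2) :=
  [set h | bijective h /\ forall x y, enorm (h x - h y) = enorm (x - y)].

(* Reflection through the line spanned by u (for u != 0).                      *)
Definition reflection (u x : 'rV[R]_2) : 'rV[R]_2 :=
  (2 * dot x u / dot u u) *: u - x.

Definition gact (u : 'rV[R]_2) (g : 'Z_2) (x : 'rV[R]_2) : 'rV[R]_2 :=
  if g == 0 then x else reflection u x.

Definition Cent (u : 'rV[R]_2) : set ('rV[R]_2 -> 'rV[R]_2) :=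
  [set h | Euc2 h /\ forall g x, h (gact u g x) = gact u g (h x)].

Lemma Cent_id u : Cent u id.
Proof. by split=> //; split=> //; exists id. Qed.

Lemma Cent_comp u h k : Cent u h -> Cent u k -> Cent u (h \o k).
Proof.
move=> [[hb hi] hc] [[kb ki] kc]; split; first split.
- exact: bij_comp.
- by move=> x y /=; rewrite hi ki.
- by move=> g x /=; rewrite kc hc.
Qed.

Lemma Cent_inv u h : Cent u h -> exists2 k, Cent u k & cancel h k.
Proof.
move=> [[[k hk kh] hi] hc]; exists k => //; split; first split.
- by exists h.
- by move=> x y; rewrite -[in RHS](kh x) -[in RHS](kh y) hi.
- by move=> g x; apply: (can_inj hk); rewrite hc !kh.
Qed.

End Plane.

Section Frameworks.
Variables (R : realType) (u : 'rV[R]_2) (G : multigraph) (phi : free_action G).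

(* {ptws _ -> _} carries the product topology, i.e. that of R^(2|V|).          *)
Definition placement := {ptws vert G -> 'rV[R]_2}.

(* The framework is cut down to an edge set A so that edge orbits can be       *)
(* removed while all vertices are kept.                                        *)
Definition realizations (l : edge G -> R) (A : {set edge G}) :
    set placement :=
  [set p | (forall e i j, e \in A -> ends e = [set i; j]%SET ->
              enorm (p j - p i) ^+ 2 = l e ^+ 2)
        /\ (forall g i, p (vact phi i g) = gact u g (p i))].

Definition congruent (l : edge G -> R) (A : {set edge G})
    (x y : realizations l A) : bool :=
  `[< exists2 h, Cent u h & forall i, set_val y i = h (set_val x i) >].

Lemma congruent_refl l A : reflexive (@congruent l A).
Proof. by move=> x; apply/asboolP; exists id => //; exact: Cent_id. Qed.

Lemma congruent_sym l A : symmetric (@congruent l A).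
Proof.
suff sym x y : @congruent l A x y -> congruent y x.
  by move=> x y; apply/idP/idP; exact: sym.
move=> /asboolP[h /Cent_inv[k kC hk] xy]; apply/asboolP.
by exists k => // i; rewrite xy hk.
Qed.

Lemma congruent_trans l A : transitive (@congruent l A).
Proof.
move=> y x z /asboolP[h hC xy] /asboolP[k kC yz]; apply/asboolP.
by exists (k \o h) => [|i]; [exact: Cent_comp | rewrite yz xy].
Qed.

Definition congruent_equiv l A : equiv_rel (realizations l A) :=
  EquivRel (@congruent l A) (@congruent_refl l A) (@congruent_sym l A)
    (@congruent_trans l A).

Definition config_space l A : topologicalType :=
  quotient_topology {eq_quot congruent_equiv l A}%qT.

Definition config l A (x : realizations l A) : config_space l A :=
  \pi_(quotient_topology {eq_quot congruent_equiv l A}%qT)%qT x.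

Definition rigid (l : edge G -> R) (A : {set edge G}) (p : placement) :=
  exists x : realizations l A,
    set_val x = p /\ isolated [set: config_space l A] (config x).

Definition minimally_rigid (l : edge G -> R) (p : placement) :=
  rigid l [set: edge G]%SET p /\
  forall e : edge G,
    ~ rigid l (~: orbit (eact phi) [set: 'Z_2] e)%SET p.

End Frameworks.

Section Generic.
Variables (R : realType) (u : 'rV[R]_2) (G : multigraph) (phi : free_action G).
Variable Q : colored_quotient phi.

(* R^(2n), the points being indexed by the n vertices of the quotient.         *)
Definition qplacement := orbit_type (vact phi) -> 'rV[R]_2.

Definition sym_placement (p : qplacement) : placement R G := fun v =>
  let w := orbit_of (vact phi) v in
  gact u (odflt 0 [pick g | vact phi (rep Q w) g == v]) (p w).

Lemma sym_placementE p w g :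
  sym_placement p (vact phi (rep Q w) g) = gact u g (p w).
Proof.
have ow : orbit_of (vact phi) (vact phi (rep Q w) g) = w.
  apply: orbit_of_eq; have /imsetP[y _ oE] := valP w.
  have := rep_mem Q w; rewrite oE => /orbit_in_eqP <- //.
  by apply: mem_orbit; rewrite inE.
rewrite /sym_placement ow; case: pickP => [h /eqP /=|/(_ g)]; last first.
  by rewrite eqxx.
have vactM v (a b : 'Z_2) : vact phi (vact phi v a) b = vact phi v (a + b).
  by rewrite -actM.
move=> /(congr1 (fun v => vact phi v (- g))); rewrite !vactM subrr.
have -> : vact phi (rep Q w) 0 = rep Q w by exact: act1.
by move=> /vact_free /subr0_eq ->.
Qed.

(* The 2n real coordinates of a point, numbered by the enumeration of          *)
(* (quotient vertex, axis) pairs.                                              *)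
Definition coords (p : qplacement)
    (k : 'I_#|{: orbit_type (vact phi) * 'I_2}|) : R :=
  p (enum_val k).1 ord0 (enum_val k).2.

Definition algebraic_subset (Z : set qplacement) :=
  exists S : set (mpoly.mpoly #|{: orbit_type (vact phi) * 'I_2}| R),
    Z = [set p | forall f, S f -> mpoly.meval (coords p) f = 0].

End Generic.

(* Main.v *)
From HB Require Import structures.
Require Import Defs.
From mathcomp Require Import all_boot all_order all_algebra all_fingroup.
From mathcomp Require Import generic_quotient.
From mathcomp Require Import boolp.
From mathcomp Require Import zify lra.

(* Write p_i = (x_i, y_i) in a frame whose first axis is the mirror.  An edge  *)
(* orbit ij of sign e = 1 or -1 has squared length                             *)
(*   (x_j - x_i)^2 + (y_j - e y_i)^2,                                          *)
(* the diagonal of a symmetric bilinear form B_ij, and the rows of the         *)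
(* rigidity matrix at p are the linear forms B_ij(p, -).                       *)
(* Since B(q, q) - B(p, p) = B(q - p, q + p), two nearby realizations have the *)
(* same lengths exactly when q - p is an infinitesimal motion of their         *)
(* midpoint m.  If the rank is 2n - 1, only translations along the mirror are  *)
(* left, so p is rigid.  If it is smaller, a polynomial field F of motions     *)
(* pinning one abscissa exists near p, and the fixed point m = p + t F(m)      *)
(* gives the realization 2m - p near p.  Hence a generic p is minimally rigid  *)
(* iff its 2n - 1 rows are independent.                                        *)
(* Independent rows satisfy the counts because each component of a subgraph    *)
(* has one or three independent trivial motions.  Conversely, a graph          *)
(* satisfying the counts is independent by induction: it has a vertex v of     *)
(* degree at most 3, which is deleted; in degree 3 the edge joining two        *)
(* neighbors of v is added, and p_v is then taken at the midpoint of their     *)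
(* copies.  One of the three possible new edges keeps the counts, since        *)
(* otherwise three tight sets would merge into one that violates them          *)
(* together with v.                                                            *)

Set Implicit Arguments.
Unset Strict Implicit.
Unset Printing Implicit Defensive.

Import GRing.Theory.

(** * Tight edge sets of sparse colored graphs *)

(** In mirror coordinates the squared length of an edge orbit is a quadratic form on placements of
    the quotient, so local rigidity is read off the rank of the rows [length_form f p]. Sliding
    along the mirror is always an infinitesimal motion, so the rank is at most 2n - 1
    ([independent_card]).

    A placement is [generic] when every edge set independent somewhere is independent at it;
    nonvanishing of one product of Gram determinants ensures this, and its zero set is Z. At such a
    placement rigidity amounts to rank 2n - 1. [full_rank_rigid] views the difference of two nearby
    realizations as a motion of their midpoint; [rigid_full_rank] turns a motion into a genuine
    nearby realization through a fixed point ([flexible_near]). Edge orbits are the edges of the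
    quotient, so minimal rigidity says that there are exactly 2n - 1 edges and that they are
    independent ([generic_minimal]).

    It remains to identify generic independence with the counts. Triviality of rho is recoded as a
    potential with values in Z/2 ([balanced_trivial], [trivial_balanced]), and the component counts
    as two inequalities for each nonempty edge set ([laman_count_sparse]). [independent_sparse]
    counts trivial motions: one in general, three for a balanced set, whose lift is a rigid body
    disjoint from its mirror image. [sparse_independent] is a Henneberg induction: a vertex v of
    degree at most 3 is removed, and in degree 3 without loops an edge between two neighbors
    replaces it. If all three candidate edges are obstructed, the obstructions merge into one tight
    set around the three neighbors ([ties_triangle]), which together with v is overfull
    ([star3_not_sparse]). *)

Lemma card_gt1 (T : finType) (A : {set T}) a b : a \in A -> b \in A -> a != b ->
  1 < #|A|.
Proof.
move=> aA bA ab; suff /subset_leq_card : [set a; b] \subset A by rewrite cards2 ab.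
by rewrite subUset !sub1set aA.
Qed.

Lemma card_gt2 (T : finType) (A : {set T}) a b c :
  a \in A -> b \in A -> c \in A -> a != b -> a != c -> b != c -> 2 < #|A|.
Proof.
move=> aA bA cA ab ac bc; rewrite (cardsD1 a) aA add1n ltnS.
by apply: (@card_gt1 _ _ b c); rewrite // !inE eq_sym ?ab ?ac.
Qed.

Lemma card_le1_eq (T : finType) (A : {set T}) a b : #|A| <= 1 ->
  a \in A -> b \in A -> a = b.
Proof.
by move=> A1 aA bA; apply/eqP; apply: contraTT A1 => ab;
  rewrite -ltnNge (card_gt1 aA bA).
Qed.

Lemma card_gt1_other (T : finType) (A : {set T}) a : 1 < #|A| ->
  exists2 d, d \in A & d != a.
Proof.
move=> A1; have: 0 < #|A :\ a| by have := cardsD1 a A; case: (a \in A); lia.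
by case/card_gt0P => d; rewrite !inE => /andP[da dA]; exists d.
Qed.

Section Tightness.
Variable H : colored_graph.
Implicit Types (E A X Y Z : {set cedge H}) (a b c d : cvert H) (al be ga : 'Z_2)
  (s t : cvert H -> 'Z_2).

Local Notation V := (@spanned_verts H).

(** A potential selects a copy of each vertex so that the selected copies carry a lift of [A]; its
    existence is equivalent to the triviality of rho on [A]. *)
Definition balanced_by s A :=
  forall f, f \in A -> s (tgt f) = (s (src f) + color f)%R.

Definition sparse E := forall A, A \subset E -> A != set0 ->
  #|A| + 1 <= 2 * #|V A| /\
  forall s, balanced_by s A -> #|A| + 3 <= 2 * #|V A|.

Lemma spanned_vertsP A v :
  reflect (exists2 f, f \in A & (v == src f) || (v == tgt f)) (v \in V A).
Proof.
rewrite inE; apply: (iffP existsP) => [[f /andP[fA vf]]|[f fA vf]].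
  by exists f.
by exists f; rewrite fA.
Qed.

Lemma src_spanned A f : f \in A -> src f \in V A.
Proof. by move=> fA; apply/spanned_vertsP; exists f; rewrite ?eqxx. Qed.

Lemma tgt_spanned A f : f \in A -> tgt f \in V A.
Proof. by move=> fA; apply/spanned_vertsP; exists f; rewrite ?eqxx ?orbT. Qed.

Lemma spanned_vertsS A X : A \subset X -> V A \subset V X.
Proof.
move=> /subsetP AX; apply/subsetP => v /spanned_vertsP[f fA vf].
by apply/spanned_vertsP; exists f => //; exact: AX.
Qed.

Lemma spanned_vertsU X Y : V (X :|: Y) = V X :|: V Y.
Proof.
apply/eqP; rewrite eqEsubset subUset !spanned_vertsS ?subsetUl ?subsetUr //.
rewrite !andbT; apply/subsetP => v /spanned_vertsP[f].
by rewrite !inE => /orP[] fX vf; apply/orP; [left|right]; apply/existsP;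
  exists f; rewrite fX.
Qed.

Lemma spanned_vertsI X Y : V (X :&: Y) \subset V X :&: V Y.
Proof. by rewrite subsetI !spanned_vertsS ?subsetIl ?subsetIr. Qed.

Lemma spanned_verts_neq0 A : A != set0 -> 0 < #|V A|.
Proof.
by case/set0Pn => f /src_spanned fA; apply/card_gt0P; exists (src f).
Qed.

Lemma balanced_byS s A X : A \subset X -> balanced_by s X -> balanced_by s A.
Proof. by move=> /subsetP AX bX f /AX /bX. Qed.

Lemma sparseS A E : A \subset E -> sparse E -> sparse A.
Proof. by move=> AE sE X XA; apply: sE; exact: subset_trans AE. Qed.

(** * Submodularity of the counts *)

Section Merging.
Variables (E : {set cedge H}) (sE : sparse E).

Lemma sparse_bound Z (W : {set cvert H}) : Z \subset E -> V Z \subset W -> 0 <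
  #|W| ->
  #|Z| + 1 <= 2 * #|W|.
Proof.
move=> ZE /subset_leq_card ZW W0; have [->|Z0] := eqVneq Z set0.
  by rewrite cards0; lia.
by have [] := sE ZE Z0; lia.
Qed.

(** Applied to the intersection of two tight sets, which may be empty. A single vertex carries no
    balanced edge, hence the constant 2 there and 3 from two vertices on. *)
Lemma balanced_bound s Z (W : {set cvert H}) : Z \subset E -> balanced_by s Z ->
  V Z \subset W ->
  0 < #|W| -> #|Z| + 2 <= 2 * #|W| /\ (1 < #|W| -> #|Z| + 3 <= 2 * #|W|).
Proof.
move=> ZE bZ /subset_leq_card ZW W0; have [->|Z0] := eqVneq Z set0.
  by rewrite cards0; lia.
by have [_ /(_ s bZ)] := sE ZE Z0; lia.
Qed.

Definition full X := 2 * #|V X| <= #|X| + 1.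
Definition balanced_full s X := balanced_by s X /\ 2 * #|V X| <= #|X| + 3.

Lemma cardsVU X Y : #|V (X :|: Y)| + #|V X :&: V Y| = #|V X| + #|V Y|.
Proof. by rewrite spanned_vertsU cardsUI. Qed.

(** Submodularity: the vertices shared by two tight sets bound their common edges, so the union
    stays tight. The same computation drives the merges below, where the constant 3 for a balanced
    intersection requires two shared vertices. *)
Lemma full_merge X Y w : X \subset E -> Y \subset E -> full X -> full Y ->
  w \in V X -> w \in V Y -> full (X :|: Y).
Proof.
rewrite /full => XE YE fX fY wX wY.
have W0 : 0 < #|V X :&: V Y| by apply/card_gt0P; exists w; rewrite in_setI wX.
have := sparse_bound (subset_trans (subsetIl X Y) XE) (spanned_vertsI X Y) W0.
by have := cardsVU X Y; have := cardsUI X Y; lia.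
Qed.

Lemma full_balanced_merge s X Y : X \subset E -> Y \subset E -> full X ->
  balanced_full s Y -> 1 < #|V X :&: V Y| -> full (X :|: Y).
Proof.
rewrite /full => XE YE fX [bY fY] W1.
have [] := balanced_bound (subset_trans (subsetIl X Y) XE)
  (balanced_byS (subsetIr X Y) bY) (spanned_vertsI X Y) (ltnW W1).
by move=> _ /(_ W1); have := cardsVU X Y; have := cardsUI X Y; lia.
Qed.

Definition glue s t X v := if v \in V X then s v else t v.

Lemma glue_balanced s t X Y : balanced_by s X -> balanced_by t Y ->
  (forall w, w \in V X -> w \in V Y -> s w = t w) ->
  balanced_by (glue s t X) (X :|: Y).
Proof.
move=> bX bY st f; rewrite inE /glue; case: (boolP (f \in X)) => /= [fX _|_ fY].
  by rewrite !(src_spanned, tgt_spanned) // bX.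
suff eq_t w : w \in V Y -> (if w \in V X then s w else t w) = t w.
  by rewrite !eq_t ?(src_spanned, tgt_spanned) // bY.
by move=> wY; case: ifP => // wX; exact: st.
Qed.

Lemma balanced_merge s t X Y : X \subset E -> Y \subset E ->
  balanced_full s X -> balanced_full t Y -> 1 < #|V X :&: V Y| ->
  (forall w, w \in V X -> w \in V Y -> s w = t w) ->
  balanced_full (glue s t X) (X :|: Y).
Proof.
move=> XE YE [bX fX] [bY fY] W1 st; split; first exact: glue_balanced.
have [] := balanced_bound (subset_trans (subsetIl X Y) XE)
  (balanced_byS (subsetIr X Y) bY) (spanned_vertsI X Y) (ltnW W1).
by move=> _ /(_ W1); have := cardsVU X Y; have := cardsUI X Y; lia.
Qed.

(* The edges common to X and Y preserve s + t, so they split along its level   *)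
(* sets in V X :&: V Y, and each of the two parts is balanced.                 *)
Lemma balanced_inter_split s t X Y b d : X \subset E -> Y \subset E ->
  balanced_by s X -> balanced_by t Y ->
  b \in V X :&: V Y -> s b = t b -> d \in V X :&: V Y -> s d != t d ->
  #|X :&: Y| + 4 <= 2 * #|V X :&: V Y| /\
  (2 < #|V X :&: V Y| -> #|X :&: Y| + 5 <= 2 * #|V X :&: V Y|).
Proof.
move=> XE YE bX bY bW sb dW sd; set W := V X :&: V Y.
pose W0 := [set w in W | s w == t w]; pose W1 := [set w in W | s w != t w].
pose Z := X :&: Y; pose Z0 := [set f in Z | src f \in W0].
pose Z1 := [set f in Z | src f \in W1].
have ZE : Z \subset E := subset_trans (subsetIl X Y) XE.
have bZ : balanced_by s Z := balanced_byS (subsetIl X Y) bX.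
have cW : #|W| = #|W0| + #|W1|.
  rewrite -(cardsID W0 W); congr (_ + _); apply: eq_card.
    by move=> w; rewrite in_setI [w \in W0]inE; case: (w \in W).
  by move=> w; rewrite in_setD [w \in W0]inE [RHS]inE; case: (w \in W);
    rewrite ?andbT.
have srcW f : f \in Z -> src f \in W.
  by move=> fZ; rewrite (subsetP (spanned_vertsI X Y)) ?src_spanned.
have tgtW f : f \in Z -> tgt f \in W.
  by move=> fZ; rewrite (subsetP (spanned_vertsI X Y)) ?tgt_spanned.
have st f : f \in Z -> (s (tgt f) == t (tgt f)) = (s (src f) == t (src f)).
  by rewrite inE => /andP[fX fY]; rewrite bX // bY // (inj_eq (addIr _)).
have cZ : #|Z| = #|Z0| + #|Z1|.
  rewrite -(cardsID Z0 Z); congr (_ + _); apply: eq_card.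
    by move=> f; rewrite inE [RHS]inE [f \in Z0]inE; case: (f \in Z).
  move=> f; rewrite inE [f \in Z0]inE [RHS]inE [_ \in W0]inE [_ \in W1]inE.
  by case: (boolP (f \in Z)) => [/srcW ->|]; rewrite /= ?andbF ?andbT.
have VZ0 : V Z0 \subset W0.
  apply/subsetP => w /spanned_vertsP[f];
    rewrite [f \in Z0]inE [_ \in W0]inE => /andP[fZ /andP[sW e0]].
  by case/orP => /eqP ->; rewrite [_ \in W0]inE ?st // e0 ?tgtW ?srcW.
have VZ1 : V Z1 \subset W1.
  apply/subsetP => w /spanned_vertsP[f];
    rewrite [f \in Z1]inE [_ \in W1]inE => /andP[fZ /andP[sW e0]].
  by case/orP => /eqP ->; rewrite [_ \in W1]inE ?st // e0 ?tgtW ?srcW.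
have sub0 : Z0 \subset Z by apply/subsetP => f; rewrite [f \in Z0]inE => /andP[].
have sub1 : Z1 \subset Z by apply/subsetP => f; rewrite [f \in Z1]inE => /andP[].
have W0_gt0 : 0 < #|W0|.
  by apply/card_gt0P; exists b; rewrite [b \in W0]inE bW sb eqxx.
have W1_gt0 : 0 < #|W1| by apply/card_gt0P; exists d; rewrite [d \in W1]inE dW sd.
have [] := balanced_bound (subset_trans sub0 ZE) (balanced_byS sub0 bZ) VZ0 W0_gt0.
have [] := balanced_bound (subset_trans sub1 ZE) (balanced_byS sub1 bZ) VZ1 W1_gt0.
by rewrite cZ cW; clear - W0_gt0 W1_gt0; lia.
Qed.

End Merging.

(** * Merging three obstructions *)

Section Triangle.
Variables (E : {set cedge H}) (sE : sparse E).

(** The pair [(a, al)] names a copy of [a] in the cover. A set [X] of this kind obstructs a new edge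
    between the copies [(a, al)] and [(b, be)], that is, one of color [al + be]; [ties3] obstructs a
    new vertex joined to three copies. *)
Definition ties X (a : cvert H) (al : 'Z_2) b (be : 'Z_2) :=
  [/\ X \subset E, a \in V X, b \in V X &
   full X \/ exists s, [/\ balanced_full s X, s a = al & s b = be]].

Definition ties3 X (a : cvert H) (al : 'Z_2) b (be : 'Z_2) c (ga : 'Z_2) :=
  [/\ X \subset E, [/\ a \in V X, b \in V X & c \in V X] &
   full X \/ exists s, [/\ balanced_full s X, s a = al, s b = be & s c = ga]].

Lemma ties_sym X a al b be : ties X a al b be -> ties X b be a al.
Proof.
by case=> XE aX bX fX; split=> //; case: fX => [|[s [? ? ?]]]; [left|right;
  exists s].
Qed.

Lemma ties3_rot X a al b be c ga : ties3 X a al b be c ga -> ties3 X b be c ga a al.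
Proof.
by case=> XE [aX bX cX] fX; split=> //; case: fX => [|[s [? ? ? ?]]];
  [left|right; exists s].
Qed.

Lemma ties3_swap X a al b be c ga : ties3 X a al b be c ga -> ties3 X b be a al c
  ga.
Proof.
by case=> XE [aX bX cX] fX; split=> //; case: fX => [|[s [? ? ? ?]]];
  [left|right; exists s].
Qed.

Lemma balanced_share s X Y : X \subset E -> Y \subset E -> balanced_by s Y ->
  0 < #|V X :&: V Y| -> #|V X :&: V Y| <= 1 -> X :&: Y = set0.
Proof.
move=> XE YE bY W0 W1.
have [] := balanced_bound sE (subset_trans (subsetIl X Y) XE)
  (balanced_byS (subsetIr X Y) bY) (spanned_vertsI X Y) W0.
by move=> H0 _; apply/eqP; rewrite -cards_eq0; clear - W1 H0; lia.
Qed.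

(** The full set [X] absorbs [Y] or [Z] if that one is full or shares two vertices with it.
    Otherwise [Y] and [Z] are balanced and have no edge in common with [X]; either they glue along
    agreeing potentials, or the union of all three is full. *)
Lemma ties3_full X Y Z a al b be c ga : (a, al) != (b, be) ->
  full X -> ties X a al b be -> ties Y b be c ga -> ties Z a al c ga ->
  exists W, ties3 W a al b be c ga.
Proof.
move=> ab fX [XE aX bX _] [YE bY cY tY] [ZE aZ cZ tZ].
have VU := spanned_vertsU.
case: tY => [fY|[s [sY sb sc]]].
  exists (X :|: Y); split; rewrite ?subUset ?XE ?VU ?in_setU ?aX ?bX ?cY ?orbT //.
  by left; exact: (full_merge sE XE YE fX fY bX bY).
case: tZ => [fZ|[t [tZ ta tc]]].
  exists (X :|: Z); split; rewrite ?subUset ?XE ?VU ?in_setU ?aX ?bX ?cZ ?orbT //.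
  by left; exact: (full_merge sE XE ZE fX fZ aX aZ).
case: (ltnP 1 #|V X :&: V Y|) => [XY|XY].
  exists (X :|: Y); split; rewrite ?subUset ?XE ?VU ?in_setU ?aX ?bX ?cY ?orbT //.
  by left; exact: (full_balanced_merge sE XE YE fX sY XY).
case: (ltnP 1 #|V X :&: V Z|) => [XZ|XZ].
  exists (X :|: Z); split; rewrite ?subUset ?XE ?VU ?in_setU ?aX ?bX ?cZ ?orbT //.
  by left; exact: (full_balanced_merge sE XE ZE fX tZ XZ).
have XY0 : X :&: Y = set0.
  apply: (balanced_share XE YE sY.1) => //.
  by apply/card_gt0P; exists b; rewrite in_setI bX.
have XZ0 : X :&: Z = set0.
  apply: (balanced_share XE ZE tZ.1) => //.
  by apply/card_gt0P; exists a; rewrite in_setI aX.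
have XW0 : #|X :&: (Y :|: Z)| = 0 by rewrite setIUr XY0 XZ0 setU0 cards0.
have YZ0 : 0 < #|V Y :&: V Z|.
  by apply/card_gt0P; exists c; rewrite in_setI cY.
have XW1 : 0 < #|V X :&: V (Y :|: Z)|.
  by apply/card_gt0P; exists a; rewrite VU in_setI in_setU aX aZ orbT.
have cXW := cardsVU X (Y :|: Z); have cYZ := cardsVU Y Z.
have eXW := cardsUI X (Y :|: Z); have eYZ := cardsUI Y Z.
have [_ fY] := sY; have [_ fZ] := tZ.
have [/existsP[d /and3P[dY dZ sd]]|/existsPn st] :=
  boolP [exists d, [&& d \in V Y, d \in V Z & s d != t d]].
  exists (X :|: (Y :|: Z)); split; rewrite ?subUset ?XE ?YE ?VU ?in_setU ?aX ?bX
    ?cY ?orbT //.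
  have dW : d \in V Y :&: V Z by rewrite in_setI dY.
  have cW : c \in V Y :&: V Z by rewrite in_setI cY.
  have sct : s c = t c by rewrite sc tc.
  have [YZ4 _] := balanced_inter_split sE YE ZE sY.1 tZ.1 cW sct dW sd.
  (* The slacks 1 + 3 + 3 of the three tight sets lose 4 by [YZ4] and 2 for a vertex shared with
     [X], which leaves 1. *)
  left; move: fX; rewrite /full; clear - cXW cYZ eXW eYZ XW0 XW1 fY fZ YZ4; lia.
have {}st w : w \in V Y -> w \in V Z -> s w = t w.
  by move=> wY wZ; apply/eqP; have := st w; rewrite wY wZ /= negbK.
case: (ltnP 1 #|V Y :&: V Z|) => [YZ|YZ].
  exists (Y :|: Z); split; rewrite ?subUset ?YE ?VU ?in_setU ?aZ ?bY ?cY ?orbT //.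
  right; exists (glue s t Y); split; first exact: (balanced_merge sE).
  - by rewrite /glue; case: ifP => // aY; rewrite st.
  - by rewrite /glue bY.
  - by rewrite /glue cY.
exists (X :|: (Y :|: Z)); split; rewrite ?subUset ?XE ?YE ?VU ?in_setU ?aX ?bX
  ?cY ?orbT //.
have abn : a != b.
  apply: contraNneq ab => ab; rewrite -ta ab -st ?sb //.
  by rewrite -ab.
have H0 : 1 < #|V X :&: V (Y :|: Z)|.
  by apply: card_gt1 abn; rewrite VU in_setI in_setU ?aX ?bX ?aZ ?bY ?orbT.
have YZe : #|Y :&: Z| = 0.
  by rewrite (balanced_share YE ZE tZ.1) ?cards0.
(* Here 1 + 3 + 3 loses 4 for [a] and [b], shared with [X], and 2 for [c], shared by [Y] and [Z]. *)
left; move: fX; rewrite /full; clear - cXW cYZ eXW eYZ XW0 YZ0 YZe fY fZ H0; lia.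
Qed.

(** A shared vertex at which the potentials differ splits the common edges ([balanced_inter_split]),
    which makes the union full as soon as a third vertex is shared. *)
Lemma balanced_pair s t X Y b : X \subset E -> Y \subset E ->
  balanced_full s X -> balanced_full t Y -> b \in V X -> b \in V Y -> s b = t b ->
  [\/ full (X :|: Y),
   (forall w, w \in V X -> w \in V Y -> s w = t w) /\
     balanced_full (glue s t X) (X :|: Y) |
   X :&: Y = set0 /\ #|V X :&: V Y| <= 2].
Proof.
move=> XE YE sX tY bX bY sb.
have bW : b \in V X :&: V Y by rewrite in_setI bX.
have [W1|W1] := leqP #|V X :&: V Y| 1.
  constructor 3; split; last exact: leq_trans W1 _.
  by apply: (balanced_share XE YE tY.1) => //; apply/card_gt0P; exists b.
have [/existsP[d /and3P[dX dY sd]]|/existsPn st] :=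
  boolP [exists d, [&& d \in V X, d \in V Y & s d != t d]]; last first.
  have {}st w : w \in V X -> w \in V Y -> s w = t w.
    by move=> wX wY; apply/eqP; have := st w; rewrite wX wY /= negbK.
  by constructor 2; split=> //; exact: (balanced_merge sE).
have dW : d \in V X :&: V Y by rewrite in_setI dX.
have [W4 W5] := balanced_inter_split sE XE YE sX.1 tY.1 bW sb dW sd.
have [W2|W2] := leqP #|V X :&: V Y| 2.
  constructor 3; split=> //; apply/eqP; rewrite -cards_eq0; clear - W2 W4; lia.
constructor 1; have := W5 W2; have := cardsVU X Y; have := cardsUI X Y.
case: sX tY => _ fX [_ fY]; rewrite /full; clear - fX fY; lia.
Qed.

(** If no two of the sets merge, they are pairwise edge-disjoint, and attaching [Y] and then [Z]
    identifies at least three vertices. Exactly three bring the slack 3 + 3 + 3 down to 3, and the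
    potentials glue; a fourth brings it down to 1, and the union is full. *)
Lemma ties3_balanced X Y Z s t r a b c :
  a != b -> b != c -> a != c ->
  X \subset E -> Y \subset E -> Z \subset E ->
  balanced_full s X -> balanced_full t Y -> balanced_full r Z ->
  a \in V X -> b \in V X -> b \in V Y -> c \in V Y -> a \in V Z -> c \in V Z ->
  s a = r a -> s b = t b -> t c = r c ->
  exists W, ties3 W a (s a) b (s b) c (t c).
Proof.
move=> ab bc ac XE YE ZE sX tY rZ aX bX bY cY aZ cZ sa sb tc.
have VU := spanned_vertsU.
case: (balanced_pair XE YE sX tY bX bY sb) => [fXY|[st bXY]|[XY0 XY2]].
- exists (X :|: Y); split; rewrite ?subUset ?XE ?VU ?in_setU ?aX ?bX ?cY ?orbT //.
  by left.
- exists (X :|: Y); split; rewrite ?subUset ?XE ?VU ?in_setU ?aX ?bX ?cY ?orbT //.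
  right; exists (glue s t X); rewrite /glue aX bX; split=> //.
  by case: ifP => // cX; rewrite st.
case: (balanced_pair XE ZE sX rZ aX aZ sa) => [fXZ|[sr bXZ]|[XZ0 XZ2]].
- exists (X :|: Z); split; rewrite ?subUset ?XE ?VU ?in_setU ?aX ?bX ?cZ ?orbT //.
  by left.
- exists (X :|: Z); split; rewrite ?subUset ?XE ?VU ?in_setU ?aX ?bX ?cZ ?orbT //.
  right; exists (glue s r X); rewrite /glue aX bX tc; split=> //.
  by case: ifP => // cX; rewrite sr.
case: (balanced_pair YE ZE tY rZ cY cZ tc) => [fYZ|[tr bYZ]|[YZ0 YZ2]].
- exists (Y :|: Z); split; rewrite ?subUset ?YE ?VU ?in_setU ?bY ?aZ ?cZ ?orbT //.
  by left.
- exists (Y :|: Z); split; rewrite ?subUset ?YE ?VU ?in_setU ?bY ?aZ ?cZ ?orbT //.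
  right; exists (glue t r Y); rewrite /glue bY cY sa sb; split=> //.
  by case: ifP => // aY; rewrite tr.
have XE' : (X :|: Y) :|: Z \subset E by rewrite !subUset XE YE.
exists ((X :|: Y) :|: Z); split; rewrite ?VU ?in_setU ?aX ?bX ?cY ?orbT //.
have eZ0 : #|(X :|: Y) :&: Z| = 0 by rewrite setIUl XZ0 YZ0 setU0 cards0.
have e0 : #|X :&: Y| = 0 by rewrite XY0 cards0.
have c1 := cardsVU X Y; have c2 := cardsVU (X :|: Y) Z.
have e1 := cardsUI X Y; have e2 := cardsUI (X :|: Y) Z.
have [[_ fX] [_ fY] [_ fZ]] := And3 sX tY rZ.
have aW : a \in V (X :|: Y) :&: V Z by rewrite VU in_setI in_setU aX aZ.
have cW : c \in V (X :|: Y) :&: V Z by rewrite VU in_setI in_setU cY cZ orbT.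
have W1 := card_gt1 aW cW ac.
have XY1 : 0 < #|V X :&: V Y| by apply/card_gt0P; exists b; rewrite in_setI bX.
have [W|W] := leqP 4 (#|V X :&: V Y| + #|V (X :|: Y) :&: V Z|).
  left; rewrite /full; clear - c1 c2 e1 e2 eZ0 e0 fX fY fZ W; lia.
right; have XY1' := XY1; have {}XY1 : #|V X :&: V Y| <= 1 by clear - W W1; lia.
have W2 : #|V (X :|: Y) :&: V Z| <= 2 by clear - W XY1' ; lia.
have onlyb w : w \in V X -> w \in V Y -> w = b.
  by move=> wX wY; apply: card_le1_eq XY1 _ _; rewrite in_setI ?wX ?bX.
have sr w : w \in V (X :|: Y) -> w \in V Z -> glue s t X w = r w.
  move=> wXY wZ.
  have wac : w = a \/ w = c.
    have [->|wa] := eqVneq w a; first by left.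
    have [->|wc] := eqVneq w c; first by right.
    have wW : w \in V (X :|: Y) :&: V Z by rewrite in_setI wXY.
    by have := card_gt2 wW aW cW wa wc ac; clear - W2; lia.
  case: wac => ->; rewrite /glue ?aX //.
  by case: ifP => // cX; move: bc; rewrite (onlyb c) ?eqxx.
exists (glue (glue s t X) r (X :|: Y)); split; first (split; last first).
- by clear - c1 c2 e1 e2 eZ0 e0 fX fY fZ XY1' W1; lia.
- apply: glue_balanced => //; last by case: rZ.
  by apply: glue_balanced => [||w wX wY]; [case: sX|case: tY|rewrite (onlyb w)].
- by rewrite /glue VU in_setU aX.
- by rewrite /glue VU in_setU bX.
rewrite /glue VU in_setU cY orbT; case: ifP => // cX.
by move: bc; rewrite (onlyb c) ?eqxx.
Qed.

Lemma ties_triangle X Y Z a al b be c ga :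
  (a, al) != (b, be) -> (b, be) != (c, ga) -> (a, al) != (c, ga) ->
  ties X a al b be -> ties Y b be c ga -> ties Z a al c ga ->
  exists W, ties3 W a al b be c ga.
Proof.
move=> ab bc ac tX tY tZ.
case: (tX) => XE aX bX [fX|[s [sX sa sb]]];
  first exact: (ties3_full ab fX tX tY tZ).
case: (tY) => YE bY cY [fY|[t [sY tb tc]]].
  have [W W3] := ties3_full bc fY tY (ties_sym tZ) (ties_sym tX).
  by exists W; do 2!apply: ties3_rot.
case: (tZ) => ZE aZ cZ [fZ|[r [sZ ra rc]]].
  have [W W3] := ties3_full ac fZ tZ (ties_sym tY) tX.
  by exists W; apply: ties3_swap; do 2!apply: ties3_rot.
rewrite -sa -sb -tc; apply: (@ties3_balanced X Y Z s t r) => //.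
- by apply: contraNneq ab => ab; rewrite -sa -sb ab.
- by apply: contraNneq bc => bc; rewrite -tb -tc bc.
- by apply: contraNneq ac => ac; rewrite -ra -rc ac.
- by rewrite sa.
- by rewrite sb.
- by rewrite tc.
Qed.

End Triangle.
End Tightness.

Import Order.TTheory Num.Theory.
Local Open Scope ring_scope.

(** * Rigidity matrices *)

Section PolynomialFunctions.
Variables (R : realFieldType) (K : Type).

(** A closure property of functions, suited to determinants of matrices that depend on [p];
    [polyfun_mpoly] converts it into actual polynomials. *)
Inductive polyfun : ((K -> R) -> R) -> Prop :=
| polyfun_const c : polyfun (fun=> c)
| polyfun_coord k : polyfun (fun p => p k)
| polyfunD f g : polyfun f -> polyfun g -> polyfun (fun p => f p + g p)
| polyfunM f g : polyfun f -> polyfun g -> polyfun (fun p => f p * g p).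

Lemma eq_polyfun f g : f =1 g -> polyfun f -> polyfun g.
Proof. by move=> /funext ->. Qed.

Lemma polyfunB f g : polyfun f -> polyfun g -> polyfun (fun p => f p - g p).
Proof.
move=> pf pg; apply: (@eq_polyfun (fun p => f p + -1 * g p)) => [p|].
  by rewrite mulN1r.
by apply: polyfunD => //; apply: polyfunM => //; exact: polyfun_const.
Qed.

Lemma polyfun_sum (I : Type) (r : seq I) (P : pred I) (F : I -> (K -> R) -> R) :
  (forall i, polyfun (F i)) -> polyfun (fun p => \sum_(i <- r | P i) F i p).
Proof.
move=> pF; elim: r => [|i r IH].
  by apply: eq_polyfun (polyfun_const 0) => p; rewrite big_nil.
case Pi: (P i).
  by apply: eq_polyfun (polyfunD (pF i) IH) => p; rewrite big_cons Pi.
by apply: eq_polyfun IH => p; rewrite big_cons Pi.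
Qed.

Lemma polyfun_prod (I : Type) (r : seq I) (P : pred I) (F : I -> (K -> R) -> R) :
  (forall i, polyfun (F i)) -> polyfun (fun p => \prod_(i <- r | P i) F i p).
Proof.
move=> pF; elim: r => [|i r IH].
  by apply: eq_polyfun (polyfun_const 1) => p; rewrite big_nil.
case Pi: (P i).
  by apply: eq_polyfun (polyfunM (pF i) IH) => p; rewrite big_cons Pi.
by apply: eq_polyfun IH => p; rewrite big_cons Pi.
Qed.

Lemma polyfun_det n (A : (K -> R) -> 'M[R]_n) :
  (forall i j, polyfun (fun p => A p i j)) -> polyfun (fun p => \det (A p)).
Proof.
move=> pA; rewrite /determinant; apply: polyfun_sum => s.
by apply: polyfunM; [exact: polyfun_const|apply: polyfun_prod].
Qed.

Lemma polyfun_mulmx m n q (A : (K -> R) -> 'M[R]_(m, n))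
    (B : (K -> R) -> 'M[R]_(n, q)) :
  (forall i j, polyfun (fun p => A p i j)) ->
  (forall i j, polyfun (fun p => B p i j)) ->
  forall i j, polyfun (fun p => (A p *m B p) i j).
Proof.
move=> pA pB i j; apply: (@eq_polyfun (fun p => \sum_k A p i k * B p k j)).
  by move=> p; rewrite mxE.
by apply: polyfun_sum => k; apply: polyfunM.
Qed.

Lemma polyfun_line f (p q : K -> R) : polyfun f ->
  exists P : {poly R}, forall t, f (fun k => p k + t * (q k - p k)) = P.[t].
Proof.
elim=> [c|k|{}f g _ [P fP] _ [Q gQ]|{}f g _ [P fP] _ [Q gQ]].
- by exists c%:P => t; rewrite hornerC.
- by exists ((p k)%:P + 'X * (q k - p k)%:P) => t; rewrite !hornerE.
- by exists (P + Q) => t; rewrite fP gQ hornerD.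
- by exists (P * Q) => t; rewrite fP gQ hornerM.
Qed.

Lemma poly_nonroot (P : {poly R}) : P != 0 -> exists t, P.[t] != 0.
Proof.
move=> P0; pose s := [seq i%:R : R | i <- iota 0 (size P)].
have : ~~ all (root P) s.
  apply/negP => /(max_poly_roots P0); rewrite size_map size_iota ltnn.
  suff -> : uniq s by move=> /(_ isT).
  by rewrite map_inj_uniq ?iota_uniq //; apply: mulrIn; rewrite oner_eq0.
by case/allPn => t _ tP; exists t.
Qed.

(** On the line through [p] and [q] both functions become nonzero univariate polynomials, whose
    product has finitely many roots in the infinite field [R]. *)
Lemma polyfun_common_nonzero f g p q : polyfun f -> polyfun g ->
  f p != 0 -> g q != 0 -> exists r, f r != 0 /\ g r != 0.
Proof.
move=> pf pg fp gq; have [P fP] := polyfun_line p q pf.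
have [Q gQ] := polyfun_line p q pg.
have P0 : P != 0.
  apply: contraNneq fp => P0; have := fP 0; rewrite P0 horner0 => <-.
  by apply/eqP; congr f; apply: funext => k; rewrite mul0r addr0.
have Q0 : Q != 0.
  apply: contraNneq gq => Q0; have := gQ 1; rewrite Q0 horner0 => <-.
  by apply/eqP; congr g; apply: funext => k; rewrite mul1r addrC subrK.
have [t] : exists t, (P * Q).[t] != 0 by apply: poly_nonroot; rewrite mulf_neq0.
rewrite hornerM -fP -gQ mulf_eq0 negb_or => /andP[ft gt].
by exists (fun k => p k + t * (q k - p k)).
Qed.

End PolynomialFunctions.

Section GramDeterminant.
Variable R : realFieldType.

Lemma row_sqr_eq0 n (v : 'rV[R]_n) : v *m v^T = 0 -> v = 0.
Proof.
move=> /matrixP /(_ 0 0); rewrite !mxE => /eqP; rewrite psumr_eq0; last first.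
  by move=> i _; rewrite mxE -expr2 sqr_ge0.
move=> /allP v0; apply/rowP => j; rewrite mxE; apply/eqP.
by have := v0 j (mem_index_enum _); rewrite mxE mulf_eq0 orbb.
Qed.

(** If [v] kills the Gram matrix, then [v *m A] has a vanishing sum of squares. This turns a rank
    condition into the nonvanishing of a single polynomial. *)
Lemma gram_det_neq0 m n (A : 'M[R]_(m, n)) : (\det (A *m A^T) != 0) = row_free A.
Proof.
rewrite -unitfE -[_ \is a GRing.unit]/(_ \in unitmx) -row_free_unit.
apply/idP/idP => [|fA].
  rewrite -!row_leq_rank => /leq_trans; apply; exact: mxrankM_maxl.
rewrite -kermx_eq0; apply/rowV0P => v /sub_kermxP vA.
apply/eqP; rewrite -(mulmx_free_eq0 _ fA); apply/eqP; apply: row_sqr_eq0.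
by rewrite trmx_mul mulmxA -(mulmxA v) vA mul0mx.
Qed.

End GramDeterminant.

(** * Independence of the rows *)

Section RigidityMatrix.
Variables (R : realFieldType) (H : colored_graph).
Local Notation K := (cvert H * bool)%type.
Implicit Types (p q : K -> R) (f : cedge H) (T : {set cedge H}).

Definition sgn (c : 'Z_2) : R := if c == 0 then 1 else -1.

Lemma Z2E (c : 'Z_2) : c = 0 \/ c = 1.
Proof. by case: c => [[|[|]]] // i; [left|right]; apply/val_inj. Qed.

Lemma sgnD c d : sgn (c + d) = sgn c * sgn d.
Proof.
by rewrite /sgn; case: (Z2E c) => ->; case: (Z2E d) => ->;
  rewrite /= ?mul1r ?mulr1 ?mulrNN ?mulr1.
Qed.

Lemma sgn_sqr c : sgn c * sgn c = 1.
Proof. by rewrite /sgn; case: ifP => _; rewrite ?mulrNN mulr1. Qed.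

(* (p (i, false), p (i, true)) are the coordinates of p_i along and across the *)
(* mirror, scaled by the norm of its direction; up to that scaling,            *)
(* length_form f p p is the squared length of the edges over f, and            *)
(* length_form f p is half the row of f in the rigidity matrix at p.           *)
Definition length_form f p q : R :=
  (p (tgt f, false) - p (src f, false)) * (q (tgt f, false) - q (src f, false)) +
  (p (tgt f, true) - sgn (color f) * p (src f, true)) *
  (q (tgt f, true) - sgn (color f) * q (src f, true)).

Local Notation B := length_form.

Definition independent T p := forall l : cedge H -> R,
  (forall q, \sum_(f in T) l f * B f p q = 0) -> forall f, f \in T -> l f = 0.

Definition unit_velocity (k : K) : K -> R := fun k' => (k' == k)%:R.

Lemma sum_unit_velocity q k0 : \sum_k q k * unit_velocity k k0 = q k0.
Proof.
rewrite (bigD1 k0) //= /unit_velocity eqxx mulr1 big1 ?addr0 // => k.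
by rewrite eq_sym => /negPf ->; rewrite mulr0.
Qed.

Lemma length_form_unit f p q : B f p q = \sum_k q k * B f p (unit_velocity k).
Proof.
rewrite -[in LHS](funext (sum_unit_velocity q)) /B.
rewrite !mulr_sumr -!sumrB !mulr_sumr -big_split /=; apply: eq_bigr => k _.
by lra.
Qed.

Lemma length_formDr f p q q' : B f p (fun k => q k + q' k) = B f p q + B f p q'.
Proof. by rewrite /B; lra. Qed.

Lemma length_formZr f p a q : B f p (fun k => a * q k) = a * B f p q.
Proof. by rewrite /B; lra. Qed.

Definition rigidity_mx T p : 'M[R]_(#|T|, #|{: K}|) :=
  \matrix_(i, k) B (enum_val i) p (unit_velocity (enum_val k)).

Definition gram T p : R := \det (rigidity_mx T p *m (rigidity_mx T p)^T).

Lemma independentP T p : independent T p <-> row_free (rigidity_mx T p).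
Proof.
split=> [iT|fT l lT f fT'].
  rewrite -kermx_eq0; apply/rowV0P => v /sub_kermxP vM; apply/rowP => i.
  pose l f := \sum_(j < #|T| | enum_val j == f) v 0 j.
  have lE j : l (enum_val j) = v 0 j.
    rewrite /l (bigD1 j) //= big1 ?addr0 // => j' /andP[/eqP /enum_val_inj ->].
    by rewrite eqxx.
  rewrite mxE -lE; apply: iT (enum_valP i) => q.
  under eq_bigr do rewrite length_form_unit mulr_sumr.
  rewrite exchange_big big1 //= => k _.
  transitivity (q k * (v *m rigidity_mx T p) 0 (enum_rank k)); last first.
    by rewrite vM mxE mulr0.
  rewrite mxE mulr_sumr [LHS]big_enum_val; apply: eq_bigr => j _.
  by rewrite lE mxE enum_rankK mulrCA.
pose v := \row_(i < #|T|) l (enum_val i).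
have v0 : v = 0.
  apply/eqP; rewrite -(mulmx_free_eq0 _ fT); apply/eqP/rowP => k; rewrite !mxE.
  rewrite -[RHS](lT (unit_velocity (enum_val k))) [RHS]big_enum_val.
  by apply: eq_bigr => i _; rewrite !mxE.
have := congr1 (fun v : 'rV_ _ => v 0 (enum_rank_in fT' f)) v0.
by rewrite !mxE enum_rankK_in.
Qed.

Lemma independent_gram T p : independent T p <-> gram T p != 0.
Proof. by rewrite independentP gram_det_neq0. Qed.

Lemma polyfun_length_form f q : polyfun (fun p => B f p q).
Proof.
by rewrite /B; apply: polyfunD; apply: polyfunM;
  do ?[exact: polyfun_const|exact: polyfun_coord|apply: polyfunB|apply: polyfunM].
Qed.

Lemma polyfun_rigidity_mx T i k : polyfun (fun p => rigidity_mx T p i k).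
Proof.
apply: eq_polyfun (polyfun_length_form (enum_val i) (unit_velocity (enum_val k))).
by move=> p; rewrite mxE.
Qed.

Lemma polyfun_gram T : polyfun (gram T).
Proof.
apply: polyfun_det; apply: polyfun_mulmx; first exact: polyfun_rigidity_mx.
move=> i j; apply: eq_polyfun (polyfun_rigidity_mx j i) => p.
by rewrite [RHS]mxE.
Qed.

Lemma independent_generic T p g q : independent T p -> polyfun g -> g q != 0 ->
  exists r, independent T r /\ g r != 0.
Proof.
move=> /independent_gram iT pg gq.
have [r [gr ?]] := polyfun_common_nonzero (polyfun_gram T) pg iT gq.
by exists r; split=> //; apply/independent_gram.
Qed.

End RigidityMatrix.

(** * Sparse colored graphs are generically independent *)

Section Stars.
Variable H : colored_graph.
Implicit Types (f g h n : cedge H) (E A X D : {set cedge H}) (v a b c : cvert H).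

Definition star E v := [set f in E | (src f == v) || (tgt f == v)].

Definition other_end v f := if src f == v then tgt f else src f.

Lemma star_sub E v : star E v \subset E.
Proof. by apply/subsetP => f; rewrite inE => /andP[]. Qed.

Lemma sum_degrees E (ends : cedge H -> cvert H) :
  (forall f, f \in E -> ends f \in spanned_verts E) ->
  (\sum_(v in spanned_verts E) #|[set f in E | ends f == v]| = #|E|)%N.
Proof.
move=> endsE; rewrite -[RHS]sum1_card (partition_big ends (mem (spanned_verts
  E))) //=.
by apply: eq_bigr => v _; rewrite -sum1_card; apply: eq_bigl => f; rewrite inE.
Qed.

(** The degrees, with loops counted twice, add up to twice the number of edges, which is less than
    four times the number of vertices. *)
Lemma low_degree_vertex E : sparse E -> E != set0 ->
  exists2 v, v \in spanned_verts E &
    (#|[set f in E | src f == v]| + #|[set f in E | tgt f == v]| <= 3)%N.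
Proof.
move=> sE E0; apply/exists_inP; apply: contraT; rewrite negb_exists_in.
move=> /forall_inP high; have [VE _] := sE E (subxx _) E0.
have : (\sum_(v in spanned_verts E) 4 <= \sum_(v in spanned_verts E)
    (#|[set f in E | src f == v]| + #|[set f in E | tgt f == v]|))%N.
  by apply: leq_sum => v /high; rewrite -ltnNge.
rewrite big_split sum_nat_const /= (sum_degrees (@src_spanned _ E)).
by rewrite (sum_degrees (@tgt_spanned _ E)); clear - VE; lia.
Qed.

Lemma sparse_loop_color E f : sparse E -> f \in E -> src f = tgt f -> color f = 1.
Proof.
move=> sE fE ff; case: (Z2E (color f)) => // f0.
have bal : balanced_by (fun=> 0) [set f] by move=> g /set1P ->; rewrite f0 addr0.
have sub : [set f] \subset E by rewrite sub1set.
have nz : [set f] != set0 by apply/set0Pn; exists f; rewrite inE.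
have [_ /(_ _ bal)] := sE _ sub nz; rewrite cards1.
suff : (#|spanned_verts [set f]| <= 1)%N by lia.
rewrite -(cards1 (src f)); apply/subset_leq_card/subsetP => w.
case/spanned_vertsP => g /set1P -> /orP[] /eqP ->; rewrite inE //.
by rewrite ff.
Qed.

(** Two edges from [v] to the same copy would form a balanced set on two vertices, where the count
    admits one edge only. *)
Lemma sparse_edges_distinct E v f g : sparse E -> f \in star E v -> g \in star E
  v ->
  src f != tgt f -> src g != tgt g -> f != g ->
  (other_end v f, color f) != (other_end v g, color g).
Proof.
move=> sE; rewrite !inE => /andP[fE fv] /andP[gE gv] ff gg fg.
apply: contraTneq isT => -[]; set w := other_end v f => wg cfg.
have inc e : e \in [set f; g] -> [/\ color e = color f, v != w &
    (src e = v /\ tgt e = w) \/ (src e = w /\ tgt e = v)].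
  have vw : v != w.
    rewrite /w /other_end; move: fv; case: eqP => [<-|] //= _ /eqP <-.
    by rewrite eq_sym.
  case/set2P => ->; split=> //.
    move: fv; rewrite /w /other_end; case: eqP => [<- _|_ /= /eqP]; first by left.
    by right.
  move: gv; rewrite wg /other_end; case: eqP => [<- _|_ /= /eqP]; first by left.
  by right.
have bal : balanced_by (fun x => if x == w then color f else 0) [set f; g].
  move=> e /inc[-> vw [[-> ->]|[-> ->]]].
    by rewrite eqxx (negPf vw) add0r.
  by rewrite eqxx (negPf vw); case: (Z2E (color f)) => ->; apply/val_inj.
have sub : [set f; g] \subset E by rewrite subUset !sub1set fE gE.
have nz : [set f; g] != set0 by apply/set0Pn; exists f; rewrite !inE eqxx.
have [_ /(_ _ bal)] := sE _ sub nz.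
suff : (#|spanned_verts [set f; g]| <= 2)%N by rewrite cards2 fg; clear; lia.
have [_ vw _] := inc f (set21 f g).
have <- : #|[set v; w]| = 2%N by rewrite cards2 vw.
apply/subset_leq_card/subsetP => x /spanned_vertsP[e /inc[_ _]].
by case=> -[-> ->] /orP[] /eqP ->; rewrite !inE eqxx ?orbT.
Qed.

(** A set that violates the counts once [n] is added contains [n]; without [n] it is tight on the
    same vertices. In the balanced case its potential is shifted by a constant to take the value
    [al] at the source of [n]. *)
Lemma not_sparse_ties E n (al be : 'Z_2) : sparse E ->
  (src n, al) != (tgt n, be) -> color n = al + be ->
  n \in E \/ ~ sparse (n |: E) -> exists X, ties E X (src n) al (tgt n) be.
Proof.
move=> sE ab cn.
have Z2double (x y : 'Z_2) : x + (x + y) = y.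
  by case: (Z2E x) => ->; case: (Z2E y) => ->; apply/val_inj.
case=> [nE|/existsNP[A /not_implyP[AE /not_implyP[A0 viol]]]].
  exists [set n]; split; rewrite ?sub1set ?src_spanned ?tgt_spanned ?set11 //.
  have V2 : spanned_verts [set n] \subset [set src n; tgt n].
    by apply/subsetP => w /spanned_vertsP[g /set1P ->]; rewrite !inE.
  have [st|st] := eqVneq (src n) (tgt n).
    by left; rewrite /full cards1; have := subset_leq_card V2;
      rewrite st setUid cards1; lia.
  right; exists (fun w => if w == src n then al else be).
  rewrite eqxx eq_sym (negPf st); split=> //; split; last first.
    by have := subset_leq_card V2; rewrite cards2 st cards1; lia.
  by move=> g /set1P ->; rewrite eqxx eq_sym (negPf st) cn Z2double.
have nA : n \in A.
  apply/negP => nA; apply: viol; apply: sE => //; apply/subsetP => g gA.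
  have := subsetP AE g gA; rewrite !inE => /orP[/eqP gn|//].
  by move: nA; rewrite -gn gA.
set X := A :\ n; have XE : X \subset E.
  by apply/subsetP => g; rewrite !inE => /andP[gn /(subsetP AE)];
    rewrite !inE (negPf gn).
have cA : #|A| = (#|X| + 1)%N by rewrite (cardsD1 n A) nA addnC.
have VX : spanned_verts X \subset spanned_verts A by apply: spanned_vertsS;
  exact: subsetDl.
have VA := spanned_verts_neq0 A0; have cX := subset_leq_card VX.
have XA_eq : (2 * #|spanned_verts A| <= 2 * #|spanned_verts X|)%N ->
    spanned_verts X = spanned_verts A.
  by move=> le; apply/eqP; rewrite eqEcard VX; clear - le; lia.
have X0 : X = set0 -> #|X| = 0%N by move=> ->; rewrite cards0.
have [le|lt] := leqP (#|A| + 1) (2 * #|spanned_verts A|); last first.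
  exists X; have [/X0 X0'|Xn0] := eqVneq X set0; first by clear - lt VA X0' cA; lia.
  have [leX _] := sE X XE Xn0.
  have eqV : spanned_verts X = spanned_verts A.
    by apply: XA_eq; clear - leX lt cA; lia.
  split; rewrite ?eqV ?src_spanned ?tgt_spanned //.
  by left; rewrite /full eqV; clear - lt cA; lia.
have [s bs lt] : exists2 s, balanced_by s A & (2 * #|spanned_verts A| < #|A| + 3)%N.
  apply: contrapT => /forall2NP bal; apply: viol; split=> // s bs.
  by rewrite leqNgt; case: (bal s) => // /negP.
exists X; have bn := bs n nA.
(* If nothing is left, [n] is a balanced loop, so its color is 0 and [al = be], against the
   assumption. *)
have [/X0 X0'|Xn0] := eqVneq X set0.
  have VA1 : (#|spanned_verts A| <= 1)%N by clear - lt X0' cA; lia.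
  have st := card_le1_eq VA1 (src_spanned nA) (tgt_spanned nA).
  have alal : al + al = 0 by case: (Z2E al) => ->; apply/val_inj.
  move: ab bn; rewrite st cn -[LHS]addr0 xpair_eqE eqxx /= => ab /addrI abz.
  by move: ab; rewrite -(inj_eq (addrI al)) -abz alal eqxx.
have [_ /(_ s (balanced_byS (subsetDl _ _) bs)) leX] := sE X XE Xn0.
have eqV : spanned_verts X = spanned_verts A.
  by apply: XA_eq; clear - leX lt cA; lia.
split; rewrite ?eqV ?src_spanned ?tgt_spanned //.
right; exists (fun w => s w + (s (src n) + al)); split.
- split; last by rewrite eqV; clear - lt cA; lia.
  by move=> g gX; rewrite (balanced_byS (subsetDl _ _) bs gX) addrAC.
- exact: Z2double.
- by rewrite bn cn addrCA addrA Z2double addrC Z2double.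
Qed.

End Stars.

(** * Adding a vertex of degree at most three *)

Section VertexExtensions.
Variables (R : realFieldType) (H : colored_graph).
Local Notation K := (cvert H * bool)%type.
Implicit Types (f g h n : cedge H) (E T X D : {set cedge H}) (v a b c : cvert H).
Implicit Types (p q : K -> R).
Local Notation sgn := (sgn R).
Local Notation B := (@length_form R H).

Definition vertex_velocity v (x y : R) : K -> R :=
  fun k => if k.1 == v then (if k.2 then y else x) else 0.

(* The displacement from the copy of p_w indexed by a color to p_v.            *)
Definition disp v w (c : 'Z_2) p (y : bool) : R :=
  p (v, y) - (if y then sgn c else 1) * p (w, y).

Lemma polyfun_disp v w (c : 'Z_2) y : polyfun (fun p => disp v w c p y).
Proof.
apply: polyfunB; first exact: polyfun_coord.
by apply: polyfunM; [exact: polyfun_const|exact: polyfun_coord].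
Qed.

Lemma length_form_disp v f p q : (src f == v) || (tgt f == v) ->
  B f p q = disp v (other_end v f) (color f) p false * disp v (other_end v f)
    (color f) q false
          + disp v (other_end v f) (color f) p true * disp v (other_end v f)
            (color f) q true.
Proof.
rewrite /length_form /disp /other_end; have := sgn_sqr R (color f).
case: eqP => [-> ss _|_ ss /= /eqP ->]; last by rewrite !mul1r.
rewrite !mul1r; congr (_ + _); first by lra.
set s := sgn _ in ss *; set pt := p (tgt f, true); set pv := p (v, true).
set qt := q (tgt f, true); set qv := q (v, true).
rewrite (_ : (pt - s * pv) = - s * (pv - s * pt) + (1 - s * s) * pt); last by lra.
rewrite (_ : (qt - s * qv) = - s * (qv - s * qt) + (1 - s * s) * qt); last by lra.
by rewrite ss subrr !mul0r !addr0 mulrACA mulrNN ss mul1r.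
Qed.

Lemma other_end_neq v f : (src f == v) || (tgt f == v) -> src f != tgt f ->
  other_end v f != v.
Proof.
rewrite /other_end => fv ff; move: fv ff; case: ifP => [/eqP -> _|-> //].
by rewrite eq_sym.
Qed.

Lemma length_form_vertex v f p x y : (src f == v) || (tgt f == v) ->
  src f != tgt f -> B f p (vertex_velocity v x y) =
  disp v (other_end v f) (color f) p false * x + disp v (other_end v f) (color f)
    p true * y.
Proof.
move=> fv ff; rewrite (length_form_disp _ _ fv) /disp /vertex_velocity /= eqxx.
by rewrite (negPf (other_end_neq fv ff)) !mulr0 !subr0.
Qed.

Lemma length_form_loop v f p x y : src f = v -> tgt f = v -> color f = 1 ->
  B f p (vertex_velocity v x y) = p (v, true) * y * 4.
Proof.
move=> sf tf cf; rewrite /length_form /vertex_velocity sf tf cf /= eqxx /sgn /=.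
by lra.
Qed.

Lemma length_form_off v f p p' q q' : ~~ ((src f == v) || (tgt f == v)) ->
  (forall w y, w != v -> p (w, y) = p' (w, y)) ->
  (forall w y, w != v -> q (w, y) = q' (w, y)) -> B f p q = B f p' q'.
Proof. by rewrite negb_or => /andP[sv tv] pp qq; rewrite /length_form !pp ?qq. Qed.

Lemma length_form_off0 v f p x y : ~~ ((src f == v) || (tgt f == v)) ->
  B f p (vertex_velocity v x y) = 0.
Proof.
move=> fv; rewrite (length_form_off (p' := p) (q' := fun=> 0) fv) //.
  by rewrite /length_form; lra.
by move=> w z /negPf wv; rewrite /vertex_velocity /= wv.
Qed.

Lemma sum_star E v (F : cedge H -> R) :
  \sum_(f in E) F f = \sum_(f in star E v) F f + \sum_(f in E :\: star E v) F f.
Proof. by rewrite (big_setID (star E v)) (setIidPr (star_sub E v)). Qed.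

Lemma not_star E v f : f \in E :\: star E v -> ~~ ((src f == v) || (tgt f == v)).
Proof. by rewrite !inE => /andP[fv fE]; move: fv; rewrite fE. Qed.

Lemma stress_at_vertex E v p (l : cedge H -> R) x y :
  (forall q, \sum_(f in E) l f * B f p q = 0) ->
  \sum_(f in star E v) l f * B f p (vertex_velocity v x y) = 0.
Proof.
move=> /(_ (vertex_velocity v x y)); rewrite (sum_star E v).
rewrite [X in _ + X]big1 ?addr0 // => f /not_star fv.
by rewrite length_form_off0 ?mulr0.
Qed.

(** Velocities supported at [v] see only the edges at [v]. Once a stress vanishes on these, it is a
    stress of the remaining edges. *)
Lemma star_extension E v p : independent (E :\: star E v) p ->
  (forall l : cedge H -> R,
     (forall x y, \sum_(f in star E v) l f * B f p (vertex_velocity v x y) = 0) ->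
     forall f, f \in star E v -> l f = 0) ->
  independent E p.
Proof.
move=> iE sI l lE; have l0 := sI l (fun x y => stress_at_vertex v x y lE).
move=> f fE; have [fs|fs] := boolP (f \in star E v); first exact: l0.
apply: iE; last by rewrite in_setD fs.
move=> q; rewrite -[RHS](lE q) (sum_star E v) [X in _ = X + _]big1 ?add0r // => g
  /l0 ->.
by rewrite mul0r.
Qed.

Definition noncollinear (d1x d1y d2x d2y : R) := d1x * d2y - d2x * d1y.

Lemma noncollinear_cancel (s t a b c d : R) : noncollinear a b c d != 0 ->
  s * a + t * c = 0 -> s * b + t * d = 0 -> s = 0 /\ t = 0.
Proof.
move=> nc e1 e2.
have s0 : s * noncollinear a b c d = (s * a + t * c) * d - (s * b + t * d) * c.
  by rewrite /noncollinear; lra.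
have t0 : t * noncollinear a b c d = (s * b + t * d) * a - (s * a + t * c) * b.
  by rewrite /noncollinear; lra.
by move: s0 t0; rewrite e1 e2 !mul0r !subrr => /eqP + /eqP;
  rewrite !mulf_eq0 (negPf nc) !orbF => /eqP -> /eqP ->.
Qed.

Lemma extend_star1 E v f p : star E v = [set f] -> sparse E ->
  independent (E :\: star E v) p -> exists p, independent E p.
Proof.
move=> sf sE iE; have : f \in star E v by rewrite sf set11.
rewrite inE => /andP[fE fv].
have [ff|ff] := eqVneq (src f) (tgt f).
  have sv : src f = v by move: fv; rewrite -ff orbb => /eqP.
  have [r [ir r0]] := independent_generic (q := fun=> 1) iE (polyfun_coord R (v,
    true)) (oner_neq0 _).
  exists r; apply: star_extension ir _ => l; rewrite sf => lE g /set1P ->.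
  have := lE 0 1; rewrite big_set1 length_form_loop ?(sparse_loop_color sE fE) //
    -?ff //.
  by move/eqP; rewrite !mulf_eq0 (negPf r0) oner_eq0 pnatr_eq0 !orbF => /eqP.
have vw := other_end_neq fv ff.
have [|r [ir r0]] := independent_generic (q := vertex_velocity v 1 0) iE
  (polyfun_disp v (other_end v f) (color f) false).
  by rewrite /disp /vertex_velocity /= eqxx (negPf vw) mulr0 subr0 oner_eq0.
exists r; apply: star_extension ir _ => l; rewrite sf => lE g /set1P ->.
have := lE 1 0; rewrite big_set1 length_form_vertex // mulr1 mulr0 addr0.
by move/eqP; rewrite mulf_eq0 (negPf r0) orbF => /eqP.
Qed.

Lemma sgn_inj : injective (sgn : 'Z_2 -> R).
Proof.
move=> c d; rewrite /sgn; case: (Z2E c) => ->; case: (Z2E d) => -> // h; exfalso;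
  move: h => /=; lra.
Qed.

Lemma sgn_neq0 (c : 'Z_2) : sgn c != 0.
Proof. by rewrite /sgn; case: ifP; rewrite ?oppr_eq0 oner_eq0. Qed.

Lemma two_directions v a b (al be : 'Z_2) : a != v -> b != v -> (a, al) != (b,
  be) ->
  exists p, noncollinear (disp v a al p false) (disp v a al p true)
                         (disp v b be p false) (disp v b be p true) != 0.
Proof.
move=> av bv ab; have [eab|nab] := eqVneq a b.
  move: ab; rewrite -eab xpair_eqE eqxx /= => ab.
  exists (fun k => (k.1 == a)%:R); rewrite /noncollinear /disp /= eqxx.
  rewrite (eq_sym v) (negPf av).
  by rewrite ?mulr0n ?mulr1n; apply: contraNneq ab => e; apply/eqP/sgn_inj; lra.
exists (fun k => if k.2 then (k.1 == b)%:R else (k.1 == a)%:R).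
rewrite /noncollinear /disp /= !eqxx (negPf nab) !(eq_sym v) (negPf bv) (negPf av).
rewrite (eq_sym b) (negPf nab).
by rewrite ?mulr0n ?mulr1n; apply: contraNneq (sgn_neq0 be) => e; apply/eqP; lra.
Qed.

Lemma extend_star2_edges E v f g p : f != g -> star E v = [set f; g] -> sparse E ->
  src f != tgt f -> src g != tgt g ->
  independent (E :\: star E v) p -> exists p, independent E p.
Proof.
move=> fg sfg sE ff gg iE.
have fs : f \in star E v by rewrite sfg set21.
have gs : g \in star E v by rewrite sfg set22.
have := sparse_edges_distinct sE fs gs ff gg fg.
move: fs gs; rewrite !inE => /andP[fE fv] /andP[gE gv] dfg.
have [q q0] := two_directions (other_end_neq fv ff) (other_end_neq gv gg) dfg.
have [||r [ir r0]] := independent_generic (q := q) (g := fun p =>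
  noncollinear (disp v (other_end v f) (color f) p false)
    (disp v (other_end v f) (color f) p true)
    (disp v (other_end v g) (color g) p false)
    (disp v (other_end v g) (color g) p true)) iE.
- by apply: polyfunB; apply: polyfunM; exact: polyfun_disp.
- exact: q0.
exists r; apply: star_extension ir _ => l; rewrite sfg => lE.
have := lE 0 1; have := lE 1 0; rewrite !big_setU1 ?inE //= !big_set1.
rewrite !length_form_vertex // !mulr0 !mulr1 !addr0 !add0r => e1 e2.
have [l1 l2] := noncollinear_cancel r0 e1 e2.
by move=> h /set2P[] ->.
Qed.

(** The loop restrains [v] across the mirror only, so the other edge has to have a nonzero component
    along the mirror. *)
Lemma extend_star2_loop E v f g p : f != g -> star E v = [set f; g] -> sparse E ->
  src f = tgt f -> src g != tgt g ->
  independent (E :\: star E v) p -> exists p, independent E p.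
Proof.
move=> fg sfg sE ff gg iE.
have : f \in star E v by rewrite sfg set21.
have : g \in star E v by rewrite sfg set22.
rewrite !inE => /andP[gE gv] /andP[fE fv].
have sv : src f = v by move: fv; rewrite -ff orbb => /eqP.
have vw := other_end_neq gv gg.
have [||r [ir]] := independent_generic
   (q := fun k => if k.2 then 1 else (k.1 == v)%:R)
   (g := fun p => p (v, true) * disp v (other_end v g) (color g) p false) iE.
- by apply: polyfunM; [exact: polyfun_coord|exact: polyfun_disp].
- by rewrite /disp /= eqxx (negPf vw) mulr0 subr0 mul1r oner_eq0.
rewrite mulf_eq0 negb_or => /andP[r0 r1].
exists r; apply: star_extension ir _ => l; rewrite sfg => lE.
have := lE 0 1; have := lE 1 0; rewrite !big_setU1 ?inE //= !big_set1.
have tv : tgt f = v by rewrite -ff.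
rewrite !(length_form_loop _ _ _ sv tv (sparse_loop_color sE fE ff)).
rewrite !length_form_vertex // !mulr0 !mulr1 !mul0r !mulr0 !addr0 !add0r.
move=> /eqP; rewrite mulf_eq0 (negPf r1) orbF => /eqP lg.
move=> /eqP; rewrite lg mul0r addr0 !mulf_eq0 (negPf r0) pnatr_eq0 !orbF => /eqP lf.
by move=> h /set2P[] ->.
Qed.

(** Distinct copies can be placed off a common line. The case of equal [a], [b], [c] is void, as a
    vertex has only two copies. *)
Lemma three_directions a b c (al be ga : 'Z_2) :
  (a, al) != (b, be) -> (b, be) != (c, ga) -> (a, al) != (c, ga) ->
  exists p, noncollinear
    (p (b, false) - p (a, false)) (sgn be * p (b, true) - sgn al * p (a, true))
    (p (c, false) - p (a, false)) (sgn ga * p (c, true) - sgn al * p (a, true))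
      != 0.
Proof.
move=> ab bc ac; rewrite /noncollinear.
have [eab|nab] := eqVneq a b.
  move: ab bc ac; rewrite -eab !xpair_eqE eqxx /= => ab bc ac.
  have [eac|nac] := eqVneq a c.
    move: ab bc ac; rewrite -eac eqxx /=.
    by case: (Z2E al) => ->; case: (Z2E be) => ->; case: (Z2E ga) => ->.
  exists (fun k => if k.2 then (k.1 == a)%:R else (k.1 == c)%:R) => /=.
  rewrite !eqxx (negPf nac) (eq_sym c) (negPf nac).
  by rewrite ?mulr0n ?mulr1n; apply: contraNneq ab => e; apply/eqP/sgn_inj; lra.
have [ebc|nbc] := eqVneq b c.
  move: bc; rewrite -ebc !xpair_eqE eqxx /= => bc.
  exists (fun k => (k.1 == b)%:R) => /=.
  rewrite !eqxx (negPf nab).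
  by rewrite ?mulr0n ?mulr1n; apply: contraNneq bc => e; apply/eqP/sgn_inj; lra.
have [eac|nac] := eqVneq a c.
  move: ac; rewrite -eac !xpair_eqE eqxx /= => ac.
  exists (fun k => if k.2 then (k.1 == a)%:R else (k.1 == b)%:R) => /=.
  rewrite !eqxx (negPf nab) (eq_sym b) (negPf nab).
  by rewrite ?mulr0n ?mulr1n; apply: contraNneq ac => e; apply/eqP/sgn_inj; lra.
exists (fun k => if k.2 then (k.1 == c)%:R else (k.1 == b)%:R) => /=.
rewrite !eqxx (negPf nab) (negPf nbc) (negPf nac) (eq_sym c) (negPf nbc).
by rewrite ?mulr0n ?mulr1n; apply: contraNneq (sgn_neq0 ga) => e; apply/eqP; lra.
Qed.

Lemma big_set3 (F : cedge H -> R) f g h : f != g -> f != h -> g != h ->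
  \sum_(e in [set f; g; h]) F e = F f + F g + F h.
Proof.
move=> fg fh gh; rewrite -setUA big_setU1 ?inE ?negb_or ?fg //=.
by rewrite big_setU1 ?inE //= big_set1 addrA.
Qed.

(* With p_v at the midpoint of the copies of p_a and p_b, a stress gives f and *)
(* g the same weight, and B f + B g is half of B n, for n = ab, on the         *)
(* velocities q with q_v at the midpoint as well.                              *)
Lemma extend_star3 E v f g h n p : f != g -> f != h -> g != h ->
  star E v = [set f; g; h] -> sparse E ->
  src f != tgt f -> src g != tgt g -> src h != tgt h ->
  src n = other_end v f -> tgt n = other_end v g -> color n = color f + color g ->
  n \notin E :\: star E v -> independent (n |: (E :\: star E v)) p ->
  exists p, independent E p.
Proof.
move=> fg fh gh sfgh sE ff gg hh sn tn cn nE iE.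
have fs : f \in star E v by rewrite sfgh !inE eqxx.
have gs : g \in star E v by rewrite sfgh !inE eqxx orbT.
have hs : h \in star E v by rewrite sfgh !inE eqxx !orbT.
have dfg := sparse_edges_distinct sE fs gs ff gg fg.
have dfh := sparse_edges_distinct sE fs hs ff hh fh.
have dgh := sparse_edges_distinct sE gs hs gg hh gh.
move: fs gs hs; rewrite !inE => /andP[fE fv] /andP[gE gv] /andP[hE hv].
have av := other_end_neq fv ff; have bv := other_end_neq gv gg;
  have cv := other_end_neq hv hh.
set a := other_end v f in sn dfg dfh av *;
  set b := other_end v g in tn dfg dgh bv *.
set c := other_end v h in dfh dgh cv *.
set al := color f in cn dfg dfh *; set be := color g in cn dfg dgh *;
  set ga := color h in dfh dgh *.
have [q0 nq0] := three_directions dfg dgh dfh.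
have [||r [ir nr]] := independent_generic (q := q0) (g := fun p => noncollinear
    (p (b, false) - p (a, false)) (sgn be * p (b, true) - sgn al * p (a, true))
    (p (c, false) - p (a, false)) (sgn ga * p (c, true) - sgn al * p (a, true))) iE.
- by rewrite /noncollinear; apply: polyfunB; apply: polyfunM; apply: polyfunB;
    do ?[apply: polyfunM]; (exact: polyfun_const || exact: polyfun_coord).
- by [].
pose mid (q : K -> R) : K -> R := fun k => if k.1 == v then
   (if k.2 then (sgn al * q (a, true) + sgn be * q (b, true)) / 2
    else (q (a, false) + q (b, false)) / 2) else q k.
have midE q w y : w != v -> mid q (w, y) = q (w, y) by rewrite /mid /= => /negPf ->.
have midx q : mid q (v, false) = (q (a, false) + q (b, false)) / 2 by rewrite
  /mid /= eqxx.
have midy q : mid q (v, true) = (sgn al * q (a, true) + sgn be * q (b, true)) / 2.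
  by rewrite /mid /= eqxx.
have dispx q w (cc : 'Z_2) : w != v -> disp v w cc (mid q) false =
     (q (a, false) + q (b, false)) / 2 - q (w, false).
  by move=> wv; rewrite /disp midx midE // mul1r.
have dispy q w (cc : 'Z_2) : w != v -> disp v w cc (mid q) true =
     (sgn al * q (a, true) + sgn be * q (b, true)) / 2 - sgn cc * q (w, true).
  by move=> wv; rewrite /disp midy midE.
exists (mid r) => l lE.
have V x y : l f * B f (mid r) (vertex_velocity v x y) +
   l g * B g (mid r) (vertex_velocity v x y) + l h * B h (mid r) (vertex_velocity
     v x y) = 0.
  by rewrite -(big_set3 (fun e => l e * B e _ _)) // -sfgh; exact: stress_at_vertex.
have := V 0 1; have := V 1 0; rewrite !length_form_vertex // !mulr0 !mulr1 !addr0
  !add0r.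
rewrite !dispx ?dispy //.
move: nr; rewrite -/a -/b -/c -/al -/be -/ga.
set d1x := r (b, false) - _; set d1y := sgn be * _ - _.
set d2x := r (c, false) - _; set d2y := sgn ga * _ - _ => nr e1 e2.
(* The displacements of [v] from the copies of [a], [b], [c] are d1 / 2, - d1 / 2 and d1 / 2 - d2;
   these are the resulting coefficients of d1 and d2. *)
have [lfgh lh] : (l f - l g + l h) / 2 = 0 /\ - l h = 0.
  apply: (noncollinear_cancel nr).
    by rewrite -[RHS]e1 /d1x /d2x; lra.
  by rewrite -[RHS]e2 /d1y /d2y; lra.
have {}lh : l h = 0 by lra.
have lfg : l g = l f by lra.
have l0 : forall e, e \in n |: (E :\: star E v) -> (if e == n then l f / 2 else l
  e) = 0.
  apply: ir => q; rewrite big_setU1 //= eqxx -[RHS](lE (mid q)) (sum_star E v).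
  congr (_ + _); last first.
    apply: eq_bigr => e eE; case: eqP => [en|_];
      first by rewrite en (negPf nE) in eE.
    by congr (_ * _); apply: length_form_off (not_star eE) _ _ => w y wv;
      rewrite midE.
  rewrite sfgh big_set3 // lfg lh mul0r addr0 !(length_form_disp _ _ fv)
    !(length_form_disp _ _ gv).
  rewrite !dispx ?dispy // -/a -/b -/al -/be /length_form sn tn cn sgnD.
  have sa := sgn_sqr R al; have sb := sgn_sqr R be.
  have -> : r (b, true) - sgn al * sgn be * r (a, true) = sgn be * d1y.
    by rewrite /d1y mulrBr !mulrA sb mul1r [sgn be * sgn al]mulrC.
  have -> : q (b, true) - sgn al * sgn be * q (a, true) =
      sgn be * (sgn be * q (b, true) - sgn al * q (a, true)).
    by rewrite mulrBr !mulrA sb mul1r [sgn be * sgn al]mulrC.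
  by rewrite mulrACA sb mul1r /d1y; lra.
have lf0 : l f = 0.
  by have := l0 n (setU11 _ _); rewrite eqxx; lra.
move=> e eE; have [|es] := boolP (e \in star E v).
  by rewrite sfgh !inE => /orP[/orP[]|] /eqP ->; rewrite ?lfg.
have eE' : e \in E :\: star E v by rewrite in_setD es.
have := l0 e (setU1r _ eE'); case: eqP => // en; by rewrite en (negPf nE) in eE'.
Qed.

End VertexExtensions.

(** * The induction on sparse graphs *)

Section Sufficiency.
Variable R : realFieldType.

(** Three edges and at most one vertex are added to the tight set [W], a gain of 3 against at most
    2. In the balanced case the potential extends by the value 0 at [v]. *)
Lemma star3_not_sparse (H : colored_graph) (E W : {set cedge H}) v f g h :
  f != g -> f != h -> g != h -> star E v = [set f; g; h] ->
  src f != tgt f -> src g != tgt g -> src h != tgt h ->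
  ties3 (E :\: star E v) W (other_end v f) (color f) (other_end v g) (color g)
    (other_end v h) (color h) -> ~ sparse E.
Proof.
move=> fg fh gh sfgh ff gg hh [WE [aW bW cW] fW] sE.
have Wv e : e \in W -> (src e != v) && (tgt e != v).
  by move=> /(subsetP WE) /not_star; rewrite negb_or.
set A := W :|: star E v.
have AE : A \subset E by rewrite subUset star_sub (subset_trans WE (subsetDl _ _)).
have cA : #|A| = (#|W| + 3)%N.
  have dWs : W :&: star E v = set0.
    apply/setP => e; rewrite in_setI in_set0; apply/negP => /andP[/(subsetP WE)].
    by rewrite in_setD => /andP[/negPf ->].
  have := cardsUI W (star E v); rewrite dWs cards0 addn0 => ->.
  rewrite sfgh -setUA !cardsU1 cards1 !inE negb_or fg fh gh //.
have A0 : A != set0 by rewrite -card_gt0 cA addn3.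
have VA : (#|spanned_verts A| <= #|spanned_verts W| + 1)%N.
  have : spanned_verts A \subset v |: spanned_verts W.
    apply/subsetP => w; rewrite spanned_vertsU in_setU in_setU1.
    case/orP => [->|]; first by rewrite orbT.
    case/spanned_vertsP => e; rewrite sfgh => eD we.
    have : other_end v e \in spanned_verts W.
      by move: eD; rewrite !in_setU !in_set1 => /orP[/orP[]|] /eqP ->.
    have : e \in star E v by rewrite sfgh.
    rewrite inE => /andP[_]; rewrite /other_end.
    case: eqP => [<- _|_ /= /eqP <-] H1; case/orP: we => /eqP ->;
      by rewrite ?eqxx ?H1 ?orbT.
  move=> /subset_leq_card /leq_trans; apply; rewrite cardsU1 addnC leq_add2l.
  by case: (_ \notin _).
have [A1 A3] := sE A AE A0; case: fW => [|[s [[bs fs] sa sb sc]]].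
  by rewrite /full; clear - A1 cA VA; lia.
suff bA : balanced_by (fun w => if w == v then 0 else s w) A.
  by have := A3 _ bA; clear - cA VA fs; lia.
move=> e; rewrite in_setU => /orP[eW|].
  by have /andP[/negPf -> /negPf ->] := Wv e eW; exact: bs.
move=> eD; have ee : src e != tgt e /\ s (other_end v e) = color e.
  by move: eD; rewrite sfgh !inE => /orP[/orP[]|] /eqP ->.
move: ee; rewrite inE in eD; case/andP: eD => _; rewrite /other_end.
case: eqP => [<- _ [/negPf ee <-]|_ /= /eqP <- [ee ->]].
  by rewrite eq_sym ee add0r.
by rewrite eqxx; case: (Z2E (color e)) => ->; apply/val_inj.
Qed.

(** Every possible colored edge is present, so the replacement edge of the degree 3 step is always
    available in the ambient graph. *)
Definition complete_graph (V : finType) := @ColoredGraph V (V * V * 'Z_2)%type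
  (fun e => e.1.1) (fun e => e.1.2) (fun e => e.2).

Lemma complete_sparse_independent (V : finType) (E : {set cedge (complete_graph
  V)}) :
  sparse E -> exists p : cvert (complete_graph V) * bool -> R, independent E p.
Proof.
have [k] := ubnP #|E|; elim: k E => // k IH E Ek sE.
have [->|E0] := eqVneq E set0.
  by exists (fun=> 0) => l _ f; rewrite inE.
have [v vE deg] := low_degree_vertex sE E0.
set D := star E v; set E' := E :\: D.
have D0 : D != set0.
  case/spanned_vertsP: vE => f fE; rewrite !(eq_sym v) => fv.
  by apply/set0Pn; exists f; rewrite inE fE.
have cE : #|E| = (#|D| + #|E'|)%N.
  by rewrite -(cardsID D E) (setIidPr (star_sub E v)).
have D_gt0 : (0 < #|D|)%N by rewrite card_gt0.
have sE' : sparse E' by apply: sparseS sE; exact: subsetDl.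
have [p ip] : exists p : cvert (complete_graph V) * bool -> R, independent E' p.
  by apply: IH => //; clear - Ek cE D_gt0; lia.
set S := [set f in E | src f == v] in deg;
  set T := [set f in E | tgt f == v] in deg.
have DST : D = S :|: T.
  by apply/setP => f; rewrite !inE andb_orr.
have cD : (#|D| + #|S :&: T| <= 3)%N by rewrite DST cardsUI.
have loop_ST f : f \in D -> src f = tgt f -> f \in S :&: T.
  by rewrite !inE => /andP[-> fv] ff; move: fv; rewrite -ff orbb => ->.
(* Loops are the members of [S :&: T] and count twice in the degree, so a loop leaves room for at
   most one more edge, itself not a loop. *)
have [/exists_inP[f fD /eqP ff]|/exists_inPn noloop] :=
    boolP [exists f in D, src f == tgt f].
  have fST := loop_ST f fD ff.
  have [Df|[g gD gf]] : D = [set f] \/ exists2 g, g \in D & g != f.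
    have [D1|D2] := leqP #|D| 1; last by right; exact: card_gt1_other.
    left; apply/esym/eqP; rewrite eqEcard sub1set fD cards1; exact: D1.
    by apply: (extend_star1 Df sE ip).
  have D2 : #|D| = 2%N.
    have := card_gt1 fD gD; rewrite eq_sym gf => /(_ isT) D2.
    have : (0 < #|S :&: T|)%N by apply/card_gt0P; exists f.
    by clear - D2 cD; lia.
  have Dfg : D = [set f; g].
    by apply/esym/eqP; rewrite eqEcard subUset !sub1set fD gD cards2 eq_sym gf D2.
  have gg : src g != tgt g.
    apply/eqP => /(loop_ST g gD) gST; have := card_gt1 fST gST.
    by rewrite eq_sym gf => /(_ isT); clear - D2 cD; lia.
  by apply: (extend_star2_loop _ Dfg sE ff gg ip); rewrite eq_sym.
have [D1|D1] := eqVneq #|D| 1%N.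
  by have /cards1P[f Df] : #|D| == 1%N by [rewrite D1];
    exact: (extend_star1 Df sE ip).
have [D2|D2] := eqVneq #|D| 2%N.
  have /cards2P[f [g [fg Dfg]]] : #|D| == 2%N by rewrite D2.
  by apply: (extend_star2_edges fg Dfg sE _ _ ip); apply: noloop;
    rewrite Dfg !inE eqxx ?orbT.
have D3 : #|D| = 3%N by clear - D_gt0 D1 D2 cD; lia.
case/set0Pn: (D0) => f fD.
have /cards2P[g [h [gh Dgh]]] : #|D :\ f| == 2%N.
  by have := cardsD1 f D; rewrite fD D3; clear; lia.
have : g \in D :\ f by rewrite Dgh set21.
have : h \in D :\ f by rewrite Dgh set22.
rewrite !in_setD1 => /andP[hf hD] /andP[gf gD].
have Dfgh : D = [set f; g; h] by rewrite -setUA -Dgh setD1K.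
(* For two of the edges at [v], either joining their other ends keeps the counts and the induction
   hypothesis applies, or a tight set ties these ends. *)
have pair (e1 e2 e3 : cedge (complete_graph V)) : e1 != e2 -> e1 != e3 -> e2 !=
  e3 ->
    D = [set e1; e2; e3] -> (exists p : V * bool -> R, independent E p) \/
    exists X, ties E' X (other_end v e1) (color e1) (other_end v e2) (color e2).
  move=> e12 e13 e23 De.
  have [e1D e2D e3D] : [/\ e1 \in D, e2 \in D & e3 \in D].
    by rewrite De !inE !eqxx ?orbT.
  pose n : cedge (complete_graph V) :=
    (other_end v e1, other_end v e2, color e1 + color e2).
  have [[nE sn]|nE] := pselect (n \notin E' /\ sparse (n |: E')).
    left; have [||q iq] := IH (n |: E') => //.
      by rewrite cardsU1 nE; clear - Ek cE D3; lia.
    exact: (extend_star3 e12 e13 e23 De sE (noloop _ e1D) (noloop _ e2D)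
      (noloop _ e3D) (n := n) _ _ _ nE iq).
  right; apply: (not_sparse_ties (n := n)) => //.
    exact: (sparse_edges_distinct sE e1D e2D (noloop _ e1D) (noloop _ e2D) e12).
  have [nE'|nE'] := boolP (n \in E'); first by left.
  by right => sn; apply: nE.
have [fg fh] : f != g /\ f != h by rewrite ![f == _]eq_sym.
have hg : h != g by rewrite eq_sym.
have Dghf : D = [set g; h; f].
  by rewrite Dfgh; apply/setP => e; rewrite !inE -orbA orbC.
have Dfhg : D = [set f; h; g].
  by rewrite Dfgh; apply/setP => e; rewrite !inE orbAC.
case: (pair f g h fg fh gh Dfgh) => // -[X tX].
case: (pair g h f gh gf hf Dghf) => // -[Y tY].
case: (pair f h g fh fg hg Dfhg) => // -[Z tZ].
have [W W3] : exists W, ties3 E' W (other_end v f) (color f) (other_end v g)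
  (color g)
    (other_end v h) (color h).
  apply: ties_triangle tX tY tZ => //.
  - exact: (sparse_edges_distinct sE fD gD (noloop _ fD) (noloop _ gD) fg).
  - exact: (sparse_edges_distinct sE gD hD (noloop _ gD) (noloop _ hD) gh).
  - exact: (sparse_edges_distinct sE fD hD (noloop _ fD) (noloop _ hD) fh).
by case: (star3_not_sparse fg fh gh Dfgh (noloop _ fD) (noloop _ gD) (noloop _
  hD) W3 sE).
Qed.

Variable H : colored_graph.

(** In a sparse set no two edges have the same source, target and color, so it embeds into the
    complete colored graph. *)
Lemma sparse_independent (E : {set cedge H}) : sparse E ->
  exists p : cvert H * bool -> R, independent E p.
Proof.
move=> sE; pose tr (f : cedge H) : cedge (complete_graph (cvert H)) :=
  (src f, tgt f, color f).
have tr_inj : {in E &, injective tr}.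
  move=> f g fE gE /= [sf tf cf]; apply/eqP/negPn/negP => fg.
  have [ff|ff] := eqVneq (src f) (tgt f).
    have sub : [set f; g] \subset E by rewrite subUset !sub1set fE gE.
    have nz : [set f; g] != set0 by apply/set0Pn; exists f; rewrite !inE eqxx.
    have [+ _] := sE _ sub nz.
    suff : (#|spanned_verts [set f; g]| <= 1)%N by rewrite cards2 fg; clear; lia.
    rewrite -(cards1 (src f)); apply/subset_leq_card/subsetP => w.
    by case/spanned_vertsP => e /set2P[] -> /orP[] /eqP ->;
      rewrite inE -?sf -?tf -?ff.
  have gg : src g != tgt g by rewrite -sf -tf.
  have fs : f \in star E (src f) by rewrite inE fE eqxx.
  have gs : g \in star E (src f) by rewrite inE gE sf eqxx.
  have := sparse_edges_distinct sE fs gs ff gg fg.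
  by rewrite /other_end -sf eqxx tf cf eqxx.
have sT : sparse (tr @: E).
  move=> A AE A0; pose A' := [set f in E | tr f \in A].
  have A'E : A' \subset E by apply/subsetP => f; rewrite inE => /andP[].
  have AA' : A = tr @: A'.
    apply/setP => e; apply/idP/imsetP => [eA|[f]];
      last by rewrite inE => /andP[_ ?] ->.
    have /imsetP[f fE ef] := subsetP AE e eA.
    by exists f => //; rewrite inE fE -ef.
  have cA : #|A| = #|A'|.
    by rewrite AA' card_in_imset // => f g /(subsetP A'E) fE /(subsetP A'E);
      exact: tr_inj.
  have VA : spanned_verts A = spanned_verts A' :> {set cvert H}.
    apply/setP => w; apply/idP/idP.
      case/(@spanned_vertsP (complete_graph (cvert H))) => e.
      by rewrite AA' => /imsetP[f fA ->] wf; apply/spanned_vertsP; exists f.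
    case/spanned_vertsP => f fA wf; apply/(@spanned_vertsP (complete_graph (cvert
      H))).
    by exists (tr f); rewrite // AA' imset_f.
  have A'0 : A' != set0 by rewrite -card_gt0 -cA card_gt0.
  have [A1 A3] := sE A' A'E A'0; rewrite VA cA; split=> // s bs; apply: (A3 s).
  by move=> f fA; apply: (bs (tr f)); rewrite AA' imset_f.
have [p ip] := complete_sparse_independent sT.
exists p => l lE f fE.
have [g gf] : exists g : cedge (complete_graph (cvert H)) -> R, forall f, f \in E
  -> g (tr f) = l f.
  exists (fun e => \sum_(f in E | tr f == e) l f) => e eE.
  rewrite (bigD1 e) ?eE ?eqxx //= big1 ?addr0 // => f' /andP[/andP[f'E /eqP ee]
    /eqP].
  by move/(tr_inj _ _ f'E eE): ee => ->.
rewrite -gf //; apply: ip; last exact: imset_f.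
move=> q; rewrite big_imset //= -[RHS](lE q).
by apply: eq_bigr => e eE; rewrite gf.
Qed.

End Sufficiency.

(** * Independent colored graphs are sparse *)

Section Potentials.
Variable H : colored_graph.
Implicit Types (f e : cedge H) (A : {set cedge H}) (v w : cvert H) (s : cvert H
  -> 'Z_2).
Implicit Types (st : cedge H * bool) (c : seq (cedge H * bool)).

Definition follows st st' := step_to st == step_from st'.

Definition signed_color st : 'Z_2 := if st.2 then color st.1 else - color st.1.

Lemma signed_color_potential s A st : balanced_by s A -> st.1 \in A ->
  signed_color st = s (step_to st) - s (step_from st).
Proof.
case: st => f b bA /= fA; rewrite /signed_color /step_to /step_from /=.
by case: b; rewrite bA //; [rewrite addrC addKr|rewrite opprD addNKr].
Qed.

Lemma rho_path s A st c : balanced_by s A -> path follows st c ->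
  all (fun st => st.1 \in A) c ->
  \sum_(t <- c) signed_color t = s (step_to (last st c)) - s (step_to st).
Proof.
move=> bA; elim: c st => [|t c IH] st /=; first by rewrite big_nil subrr.
move=> /andP[/eqP stt pc] /andP[tA cA]; rewrite big_cons (IH t) //.
by rewrite (signed_color_potential bA tA) stt addrC addrA subrK.
Qed.

Lemma balanced_trivial s A : balanced_by s A -> trivial_image A.
Proof.
move=> bA [|st c]; first by rewrite /rho big_nil.
case/and4P=> /= /andP[stA cA] pc _ _.
have := rho_path bA pc; rewrite all_rcons stA cA last_rcons subrr => /(_ isT) <-.
by rewrite /rho -[LHS]/(\sum_(t <- st :: c) signed_color t) -cats1 big_cat
  big_seq1 big_cons addrC.
Qed.

(** A later repetition of the edge leaving [x] would make the path return to [x], so the edges are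
    distinct. The step [st] is the one preceding the walk. *)
Lemma walk_of_path A x p st : path (adjacent A) x p -> uniq (x :: p) ->
  step_to st = x -> exists c,
  [/\ all (fun st => st.1 \in A) c, path follows st c,
      map (@step_from H) c = belast x p, map (@step_to H) c = p &
      uniq (map fst c)].
Proof.
elim: p x st => [|y p IH] x st /=; first by exists [::].
case/andP=> /existsP[f /andP[fA fxy]] pp /andP[xyp uyp] stx.
have [b [fb tb]] : exists b, step_from (f, b) = x /\ step_to (f, b) = y.
  by case/orP: fxy => /andP[/eqP sf /eqP tf]; [exists true|exists false].
have [c [cA pc fc tc uc]] := IH y (f, b) pp uyp tb.
exists ((f, b) :: c); split=> //=.
- by rewrite fA.
- by rewrite /follows stx fb eqxx.
- by rewrite fb fc.
- by rewrite tb tc.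
rewrite uc andbT; apply/negP => /mapP[[g b'] gc /= fg]; case/negP: xyp.
have := map_f (@step_to H) gc; have := map_f (@step_from H) gc; rewrite fc tc.
move=> /mem_belast; rewrite -fg -fb /step_from /step_to /=.
by case: (b); case: (b') => // _; rewrite inE => ->; rewrite orbT.
Qed.

Lemma adjacent_sym A : symmetric (adjacent A).
Proof. by move=> v w; apply: eq_existsb => f; rewrite orbC. Qed.

Lemma connect_adjacent_sym A : connect_sym (adjacent A).
Proof. by apply: sym_connect_sym; exact: adjacent_sym. Qed.

Lemma connect_ends A f v : f \in A ->
  connect (adjacent A) v (tgt f) = connect (adjacent A) v (src f).
Proof.
move=> fA; have st : connect (adjacent A) (src f) (tgt f).
  by apply: connect1; apply/existsP; exists f; rewrite fA !eqxx.
apply/idP/idP => h; apply: connect_trans h _ => //.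
by rewrite connect_adjacent_sym.
Qed.

(** Edges are restored one at a time. If the potential fails on the new edge [e], then either a path
    between its ends closes up to a simple cycle with nonzero rho, or the potential can be flipped
    on the component of [tgt e]. *)
Lemma trivial_balanced A : trivial_image A -> exists s, balanced_by s A.
Proof.
have [k] := ubnP #|A|; elim: k A => // k IH A Ak tA.
have [->|/set0Pn[e eA]] := eqVneq A set0; first by exists (fun=> 0) => f;
  rewrite inE.
set A' := A :\ e; have A'A : A' \subset A by exact: subsetDl.
have sub_all c : all (fun st => st.1 \in A') c -> all (fun st => st.1 \in A) c.
  by apply: sub_all => st; exact: (subsetP A'A).
have [||s bs] := IH A'; first by have := cardsD1 e A; rewrite eA -/A';
  clear - Ak; lia.
  by move=> c /and4P[cA *]; apply: tA; apply/and4P; split=> //; exact: sub_all.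
have ext s' : balanced_by s' A' -> s' (tgt e) = s' (src e) + color e ->
  balanced_by s' A.
  move=> bs' se f fA; have [->//|fe] := eqVneq f e.
  by apply: bs'; rewrite !inE fe.
have [se|se] := eqVneq (s (tgt e)) (s (src e) + color e); first by exists s;
  exact: ext.
have [/connectP[p pp]|nc] := boolP (connect (adjacent A') (tgt e) (src e)).
  case/shortenP: pp => {}p pp up _ pe.
  have [c [cA pc fc tc uc]] := walk_of_path (st := (e, true)) pp up erefl.
  have last_c : step_to (last (e, true) c) = src e.
    rewrite pe; case/lastP: (c) tc => [|c' t] /= <- //.
    by rewrite map_rcons !last_rcons.
  case/eqP: se; apply/eqP; rewrite -subr_eq0 opprD addrA -oppr_eq0; apply/eqP.
  have <- : rho ((e, true) :: c) = 0.
    apply: tA; apply/and4P; split=> /=.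
    - by rewrite eA sub_all.
    - by rewrite rcons_path pc /= last_c.
    - rewrite fc; have := up; rewrite lastI rcons_uniq -pe => /andP[pu ->].
      by rewrite andbT.
    - rewrite uc andbT; apply/negP => /mapP[t tc' et].
      by have := allP cA t tc'; rewrite -et !inE eqxx.
  rewrite /rho -[RHS]/(\sum_(t <- (e, true) :: c) signed_color t) big_cons.
  rewrite (rho_path bs pc cA) last_c /signed_color /step_to /=.
  by rewrite opprD opprB opprK addrC addrA; congr (_ + _); rewrite addrC.
exists (fun w => if connect (adjacent A') (tgt e) w then s w + 1 else s w).
apply: ext => [f fA|].
  by rewrite connect_ends // bs //; case: ifP => // _; rewrite addrAC.
rewrite connect0 (negPf nc); move: se.
by case: (Z2E (s (tgt e))) => ->; case: (Z2E (s (src e) + color e)) => ->;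
  rewrite ?eqxx // => _; apply/val_inj.
Qed.

End Potentials.

(** * From component counts to sparsity *)

Section Components.
Variable H : colored_graph.
Implicit Types (f e : cedge H) (A : {set cedge H}) (C : {set cvert H}).

Lemma components_partition A : partition (components A) (spanned_verts A).
Proof.
apply: equivalence_partitionP => x y z _ _ _; split; first exact: connect0.
by move=> xy; apply/idP/idP => h;
  [apply: connect_trans _ h; rewrite connect_adjacent_sym|exact: connect_trans xy
    h].
Qed.

Lemma component_ends A C f : C \in components A -> f \in A ->
  (tgt f \in C) = (src f \in C).
Proof.
case/imsetP => x _ -> fA; rewrite inE [RHS]inE.
by rewrite src_spanned ?tgt_spanned ?connect_ends.
Qed.

Lemma component_edges_verts A C : C \in components A ->
  spanned_verts (component_edges A C) \subset C.
Proof.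
move=> CA; apply/subsetP => v /spanned_vertsP[f]; rewrite inE => /andP[fA fC].
by case/orP => /eqP -> //; rewrite (component_ends CA fA).
Qed.

Lemma component_edges_neq0 A C : C \in components A -> component_edges A C != set0.
Proof.
move=> CA; have /and3P[/eqP covA _ n0] := components_partition A.
have /set0Pn[v vC] : C != set0 by apply: contraNneq n0 => <-.
have : v \in spanned_verts A by rewrite -covA; apply/bigcupP; exists C.
case/spanned_vertsP => f fA vf; apply/set0Pn; exists f; rewrite inE fA.
by case/orP: vf => /eqP vf; [rewrite -vf|rewrite -(component_ends CA fA) -vf].
Qed.

Lemma card_component_edges A :
  (\sum_(C in components A) #|component_edges A C| = #|A|)%N.
Proof.
have /and3P[/eqP covA triv _] := components_partition A.
rewrite -[RHS]sum1_card.
rewrite (partition_big (fun f => pblock (components A) (src f)) (mem (components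
  A))) /=.
  apply: eq_bigr => C CA; rewrite -sum1_card; apply: eq_bigl => f.
  rewrite inE; case: (boolP (f \in A)) => //= fA.
  have sf : src f \in cover (components A) by rewrite covA src_spanned.
  apply/idP/eqP => [fC|<-]; first exact: (def_pblock triv CA fC).
  by rewrite mem_pblock.
by move=> f fA; rewrite pblock_mem // covA src_spanned.
Qed.

Lemma card_trivial_nontrivial A :
  (#|nontrivial_components A| + #|trivial_components A| = #|components A|)%N.
Proof.
rewrite -(cardsID (trivial_components A) (components A)) addnC.
congr (_ + _)%N; apply: eq_card => C; rewrite !inE.
  by case: (C \in components A).
by case: (C \in components A) => //=; rewrite andbT.
Qed.

(** A nonempty set has a component, and a potential makes all its components trivial. Conversely,
    the inequalities for the components add up to the count. *)
Lemma laman_count_sparse :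
  (forall A, (0 < #|A|)%N ->
     #|A|%:Z <= 2 * #|spanned_verts A|%:Z - #|nontrivial_components A|%:Z
                - 3 * #|trivial_components A|%:Z) <->
  sparse [set: cedge H].
Proof.
split=> [laman A _ A0|sp A A0].
  have cA : (0 < #|components A|)%N.
    have /set0Pn[f fA] := A0; have /and3P[/eqP covA _ _] := components_partition A.
    have : src f \in cover (components A) by rewrite covA src_spanned.
    by case/bigcupP => C CA _; apply/card_gt0P; exists C.
  have := laman A; rewrite card_gt0 => /(_ A0).
  have := card_trivial_nontrivial A => ctn le; split; first by clear - cA ctn le;
    lia.
  move=> s bs; suff nt0 : #|nontrivial_components A| = 0%N.
    by clear - cA ctn le nt0; lia.
  apply/eqP; rewrite cards_eq0; apply/eqP/setP => C; rewrite !inE.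
  apply/negP => /andP[CA /negP]; apply; apply/asboolP;
    apply: (@balanced_trivial _ s).
  by apply: balanced_byS bs; apply/subsetP => f; rewrite inE => /andP[].
have bound C : C \in components A ->
    (#|component_edges A C| + (if C \in trivial_components A then 3 else 1) <= 2
      * #|C|)%N.
  move=> CA; have [b1 b3] := sp _ (subsetT _) (component_edges_neq0 CA).
  have := subset_leq_card (component_edges_verts CA).
  rewrite inE CA /=; case: asboolP => [/trivial_balanced[s /b3]|_].
    by clear; lia.
  by move: b1; clear; lia.
have : (\sum_(C in components A) (#|component_edges A C| +
    (if C \in trivial_components A then 3 else 1)) <= \sum_(C in components A) 2
      * #|C|)%N.
  exact: leq_sum.
rewrite big_split /= card_component_edges -big_distrr /= -(card_partition
  (components_partition A)).
have -> : (\sum_(C in components A) (if C \in trivial_components A then 3 else 1) =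
    3 * #|trivial_components A| + #|nontrivial_components A|)%N.
  rewrite (bigID (fun C => C \in trivial_components A)) /=; congr (_ + _)%N.
    rewrite (eq_bigr (fun=> 3)); last by move=> C /andP[_ ->].
    rewrite sum_nat_const mulnC; congr (_ * _)%N; apply: eq_card => C.
    by rewrite unfold_in /= inE; case: (C \in components A).
  rewrite (eq_bigr (fun=> 1%N)); last by move=> C /andP[_ /negPf ->].
  rewrite sum1_card; apply: eq_card => C; rewrite unfold_in /= !inE.
  by case: (C \in components A).
move: #|A| #|trivial_components A| #|nontrivial_components A| #|spanned_verts A|
  => a b c d; clear; lia.
Qed.

End Components.

(** * Trivial motions bound the number of independent rows *)

Section Necessity.
Variables (R : realFieldType) (H : colored_graph).
Local Notation K := (cvert H * bool)%type.
Implicit Types (f g : cedge H) (E A : {set cedge H}) (v : cvert H) (W : {set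
  cvert H}).
Implicit Types (p q : K -> R).
Local Notation sgn := (sgn R).
Local Notation B := (@length_form R H).

Lemma independentS A E p : A \subset E -> independent E p -> independent A p.
Proof.
move=> AE iE l lA f fA.
have := iE (fun f => if f \in A then l f else 0) _ f (subsetP AE _ fA).
rewrite fA; apply=> q; rewrite -[RHS](lA q) (big_setID A) /= (setIidPr AE).
rewrite [X in _ + X]big1 ?addr0; last first.
  by move=> g; rewrite inE => /andP[/negPf -> _]; rewrite mul0r.
by apply: eq_bigr => g ->.
Qed.

Lemma independent_length_form_neq0 E p f : independent E p -> f \in E ->
  exists q, B f p q != 0.
Proof.
move=> iE fE; apply: contrapT => /forallNP B0.
have iF : independent [set f] p by apply: independentS iE; rewrite sub1set.
suff /eqP : (1 : R) = 0 by rewrite oner_eq0.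
apply: (iF (fun=> 1) _ f (set11 f)) => q; rewrite big_set1 mul1r.
by apply/eqP/negPn/negP => /B0.
Qed.

Lemma length_form_unit_off A W f p (k : K) : spanned_verts A \subset W -> f \in A ->
  k.1 \notin W -> B f p (unit_velocity R k) = 0.
Proof.
move=> AW fA kW; have ends0 (v : cvert H) z : v \in spanned_verts A ->
  unit_velocity R k (v, z) = 0.
  move=> /(subsetP AW) vW; rewrite /unit_velocity; case: eqP => // vk.
  by rewrite -vk vW in kW.
by rewrite /length_form !ends0 ?src_spanned ?tgt_spanned // !(mulr0, subrr, addr0).
Qed.

(* Rank-nullity on the columns of W. *)
Lemma independent_nullity A W p d (w : 'I_d -> K -> R) : independent A p ->
  spanned_verts A \subset W ->
  (forall f i, f \in A -> B f p (w i) = 0) ->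
  (forall a : 'I_d -> R, (forall k, k.1 \in W -> \sum_i a i * w i k = 0) ->
     forall i, a i = 0) ->
  (d + #|A| <= 2 * #|W|)%N.
Proof.
move=> iA AW wker wind; pose KW := [set k : K | k.1 \in W].
have cKW : #|KW| = (2 * #|W|)%N.
  have -> : KW = setX W [set: bool] by apply/setP => k; rewrite !inE andbT.
  by rewrite cardsX cardsT card_bool mulnC.
pose M := \matrix_(i < #|A|, k < #|KW|) B (enum_val i) p (unit_velocity R
  (enum_val k)).
pose N := \matrix_(i < d, k < #|KW|) w i (enum_val k).
have sumKW f q : f \in A -> \sum_(k < #|KW|) q (enum_val k) *
    B f p (unit_velocity R (enum_val k)) = B f p q.
  move=> fA; rewrite -(big_enum_val (A := mem KW) (fun k => q k * B f p
    (unit_velocity R k))) /=.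
  rewrite [RHS]length_form_unit [RHS](bigID (fun k => k \in KW)) /=.
  rewrite [X in _ = _ + X]big1 ?addr0 // => k; rewrite inE => kW.
  by rewrite (length_form_unit_off _ AW fA kW) mulr0.
have fM : row_free M.
  rewrite -kermx_eq0; apply/rowV0P => x /sub_kermxP xM; apply/rowP => i.
  pose l f := \sum_(j < #|A| | enum_val j == f) x 0 j.
  have lE j : l (enum_val j) = x 0 j.
    rewrite /l (bigD1 j) //= big1 ?addr0 // => j' /andP[/eqP /enum_val_inj ->].
    by rewrite eqxx.
  rewrite mxE -lE; apply: iA (enum_valP i) => q.
  rewrite big_enum_val /=.
  under eq_bigr => j _ do rewrite lE -(sumKW _ _ (enum_valP j)) mulr_sumr.
  rewrite exchange_big big1 //= => k _.
  transitivity (q (enum_val k) * (x *m M) 0 k); last by rewrite xM mxE mulr0.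
  by rewrite mxE mulr_sumr; apply: eq_bigr => j _; rewrite mxE mulrCA.
have fN : row_free N.
  rewrite -kermx_eq0; apply/rowV0P => x /sub_kermxP xN; apply/rowP => i.
  rewrite mxE; apply: (wind (fun i => x 0 i)) => k kW.
  have kKW : k \in KW by rewrite inE.
  have /rowP/(_ (enum_rank_in kKW k)) := xN; rewrite !mxE => e; rewrite -[RHS]e.
  by apply: eq_bigr => j _; rewrite mxE enum_rankK_in.
have NM : N *m M^T = 0.
  apply/matrixP => i j; rewrite !mxE -[RHS](wker (enum_val j) i) ?enum_valP //.
  rewrite -(sumKW _ _ (enum_valP j)); apply: eq_bigr => k _.
  by rewrite !mxE.
have := mulmx0_rank_max NM; rewrite mxrank_tr.
by move: fM fN; rewrite /row_free => /eqP -> /eqP ->; rewrite cKW.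
Qed.

Definition slide : K -> R := fun k => if k.2 then 0 else 1.

Lemma length_form_slide f p : B f p slide = 0.
Proof. by rewrite /length_form /slide /=; lra. Qed.

(** A balanced set lifts to a body and its mirror image, which follows any motion of the body. This
    and [lifted_rotation] are the translation across the mirror and the rotation of that body; the
    signs carry the velocities back to the chosen representatives. *)
Definition lifted_rise (s : cvert H -> 'Z_2) : K -> R :=
  fun k => if k.2 then sgn (s k.1) else 0.

Definition lifted_rotation (s : cvert H -> 'Z_2) p : K -> R :=
  fun k => if k.2 then sgn (s k.1) * p (k.1, false) else - (sgn (s k.1) * p (k.1,
    true)).

Lemma independent_sparse E p : independent E p -> sparse E.
Proof.
move=> iE A AE A0; have iA := independentS AE iE.
have /set0Pn[f fA] := A0; have fE := subsetP AE f fA.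
split=> [|s bs].
  rewrite addnC; apply: (independent_nullity (w := fun _ : 'I_1 => slide) iA
    (subxx _)).
    by move=> *; exact: length_form_slide.
  move=> a a0 i; have := a0 (src f, false) (src_spanned fA).
  by rewrite big_ord1 /slide /= mulr1 (ord1 i).
have eps g : g \in A -> sgn (color g) = sgn (s (tgt g)) * sgn (s (src g)).
  by move=> gA; rewrite bs // sgnD mulrAC sgn_sqr mul1r.
pose w (i : 'I_3) : K -> R :=
  nth slide [:: slide; lifted_rise s; lifted_rotation s p] i.
have w_sum (a : 'I_3 -> R) k : \sum_i a i * w i k =
    a ord0 * slide k + a (lift ord0 ord0) * lifted_rise s k
    + a (lift ord0 (lift ord0 ord0)) * lifted_rotation s p k.
  by rewrite !big_ord_recl big_ord0 addr0 addrA.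
rewrite addnC; apply: (independent_nullity (w := w) iA (subxx _)) => [g i gA|a a0].
  have ss := sgn_sqr R (s (src g)); have tt := sgn_sqr R (s (tgt g)).
  case: i => [[|[|[|//]]]] ?; rewrite /w /=; first exact: length_form_slide.
    rewrite /length_form /lifted_rise /= eps //.
    by rewrite -[_ * sgn (s (src g)) * sgn (s (src g))]mulrA ss mulr1 !subrr
      !mulr0 addr0.
  rewrite /length_form /lifted_rotation /= eps //.
  set si := sgn (s (src g)) in ss *; set tj := sgn (s (tgt g)) in tt *.
  have -> : tj * p (tgt g, false) - tj * si * (si * p (src g, false)) =
     tj * (p (tgt g, false) - (si * si) * p (src g, false)) by lra.
  rewrite ss mul1r.
  have -> : (p (tgt g, true) - tj * si * p (src g, true)) *
      (tj * (p (tgt g, false) - p (src g, false))) =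
    (tj * p (tgt g, true) - (tj * tj) * (si * p (src g, true))) *
      (p (tgt g, false) - p (src g, false)) by lra.
  by rewrite tt mul1r; lra.
pose a2 := a (lift ord0 (lift ord0 ord0)).
have ax g v : g \in A -> (v == src g) || (v == tgt g) -> [/\
    a ord0 = a2 * (sgn (s v) * p (v, true)) & a (lift ord0 ord0) = - a2 * p (v,
      false)].
  move=> gA vg; have vA : v \in spanned_verts A by apply/spanned_vertsP; exists g.
  have := a0 (v, false) vA; have := a0 (v, true) vA.
  rewrite !w_sum /slide /lifted_rise /lifted_rotation /= -/a2 => e1 e2; split;
    first by lra.
  have : sgn (s v) * sgn (s v) * (a (lift ord0 ord0) + a2 * p (v, false)) = 0.
    by rewrite -mulrA mulrDr -[RHS](mulr0 (sgn (s v))) -e1; lra.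
  by rewrite sgn_sqr; lra.
have [e1 e2] := ax f (src f) fA (introT orP (or_introl (eqxx _))).
have [e3 e4] := ax f (tgt f) fA (introT orP (or_intror (eqxx _))).
(* A relation that involves the rotation would make the two lifted ends of [f] coincide, and the row
   of the independent edge [f] would vanish. *)
have a20 : a2 = 0.
  apply/eqP; apply: contraT => a2n0.
  have px : p (src f, false) = p (tgt f, false).
    by apply: (mulfI a2n0); lra.
  have py : sgn (s (src f)) * p (src f, true) = sgn (s (tgt f)) * p (tgt f, true).
    by apply: (mulfI a2n0); lra.
  have [q /eqP] := independent_length_form_neq0 iE fE; case.
  rewrite /length_form px subrr mul0r add0r eps // -mulrA py mulrA sgn_sqr mul1r.
  by rewrite subrr mul0r.
move=> i; rewrite a20 in e1 e2.
case: i => [[|[|[|//]]]] i3.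
- by rewrite (_ : Ordinal i3 = ord0); [lra|apply/val_inj].
- by rewrite (_ : Ordinal i3 = lift ord0 ord0); [lra|apply/val_inj].
- by rewrite -[RHS]a20 /a2; congr a; apply/val_inj.
Qed.

End Necessity.

From mathcomp Require Import classical_sets functions reals topology normedtype.
From mathcomp Require Import interval_inference sequences.
From mathcomp Require Import (canonicals) mpoly.
Import numFieldNormedType.Exports.

(** * Rigidity and flexibility in coordinates *)

Section LocallyLipschitz.
Variables (R : realFieldType) (K : Type).
Implicit Types (p q r : K -> R).

Definition within_box p (d : R) q := forall k, `|q k - p k| <= d.

Lemma polyfun_lipschitz f p : polyfun f -> exists2 L, 0 <= L &
  forall q r D, within_box p 1 q -> within_box p 1 r -> within_box q D r ->
  0 <= D -> `|f r - f q| <= L * D.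
Proof.
elim=> [c|k|{}f g _ [L L0 fL] _ [M M0 gM]|{}f g _ [L L0 fL] _ [M M0 gM]].
- by exists 0 => // *; rewrite subrr normr0 mul0r.
- by exists 1 => // q r D _ _ qr _; rewrite mul1r; exact: qr.
- exists (L + M); first exact: addr_ge0.
  move=> q r D pq pr qr D0; rewrite opprD addrACA mulrDl.
  by apply: (le_trans (ler_normD _ _)); rewrite lerD ?fL ?gM.
exists ((`|f p| + L) * M + (`|g p| + M) * L).
  by rewrite addr_ge0 ?mulr_ge0 ?addr_ge0.
move=> q r D pq pr qr D0.
have pp : within_box p 1 p by move=> k; rewrite subrr normr0.
have fr : `|f r| <= `|f p| + L.
  have := fL p r 1 pp pr pr ler01; rewrite mulr1 => frp.
  by rewrite -[f r](subrK (f p)) addrC (le_trans (ler_normD _ _)) // lerD2l.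
have gq : `|g q| <= `|g p| + M.
  have := gM p q 1 pp pq pq ler01; rewrite mulr1 => gqp.
  by rewrite -[g q](subrK (g p)) addrC (le_trans (ler_normD _ _)) // lerD2l.
have -> : f r * g r - f q * g q = f r * (g r - g q) + g q * (f r - f q) by lra.
rewrite mulrDl -!mulrA; apply: (le_trans (ler_normD _ _)); rewrite !normrM.
by apply: lerD; apply: ler_pM => //; [exact: gM|exact: fL].
Qed.

Lemma polyfun_nonzero_near f p : polyfun f -> f p != 0 ->
  exists2 d, 0 < d <= 1 & forall q, within_box p d q -> f q != 0.
Proof.
move=> /(@polyfun_lipschitz _ p)[L L0 fL] fp; set a := `|f p|.
have a0 : 0 < a by rewrite normr_gt0.
have La : 0 < L + 1 + a by rewrite -addrA ltr_wpDl // addr_gt0.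
(* This radius is at most 1, and [L] times it stays below [a]. *)
exists (a / (L + 1 + a)) => [|q pq].
  by rewrite divr_gt0 // ler_pdivrMr // mul1r lerDr addr_ge0.
have d1 : a / (L + 1 + a) <= 1 by rewrite ler_pdivrMr // mul1r lerDr addr_ge0.
have pp : within_box p 1 p by move=> k; rewrite subrr normr0.
have pq1 : within_box p 1 q by move=> k; exact: le_trans (pq k) d1.
have := fL p q _ pp pq1 pq (divr_ge0 (ltW a0) (ltW La)).
have lt : L * (a / (L + 1 + a)) < a.
  rewrite mulrCA gtr_pMr // ltr_pdivrMr // mul1r -addrA ltrDl; lra.
apply: contraTneq => ->; rewrite sub0r normrN -ltNge; exact: lt.
Qed.

End LocallyLipschitz.

HB.instance Definition _ (R : realType) (n : nat) := Complete.copy 'rV[R]_n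
  'rV[R]_n.

(** * Fixed points of small polynomial perturbations *)

Section FixedPoint.
Variables (R : realType) (K : finType).
Implicit Types (p : K -> R).

Lemma row_norm_le n (x : 'rV[R]_n) e : 0 <= e ->
  (`|x| <= e) <-> (forall j, `|x ord0 j| <= e).
Proof.
move=> e0; rewrite [`|x|]mx_normrE; split=> [/bigmax_leP[_ xe] j|xe].
  exact: (xe (ord0, j)).
by apply/bigmax_leP; split=> // -[i j] _ /=; rewrite (ord1 i).
Qed.

(* Banach's theorem for the perturbation p + t F of the constant map p.        *)
Lemma polyfun_fixed_point (F : K -> (K -> R) -> R) p d :
  (forall k, polyfun (F k)) -> 0 < d <= 1 ->
  exists t m, [/\ 0 < t, within_box p d m & forall k, m k = p k + t * F k m].
Proof.
move=> pF /andP[d0 d1].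
have /choice[L LP] : forall k, exists L, 0 <= L /\ forall q r D,
    within_box p 1 q -> within_box p 1 r -> within_box q D r ->
    0 <= D -> `|F k r - F k q| <= L * D.
  by move=> k; have [L L0 LF] := polyfun_lipschitz p (pF k); exists L.
pose C := \sum_k (L k + `|F k p|).
have LC k : L k + `|F k p| <= C.
  rewrite /C (bigD1 k) //= lerDl sumr_ge0 // => j _.
  by rewrite addr_ge0 //; have [] := LP j.
have C0 : 0 <= C by rewrite sumr_ge0 // => k _; rewrite addr_ge0 //;
  have [] := LP k.
have C1 : 0 < 2 * (C + 1) by lra.
(* As [C] bounds both the Lipschitz constants and the values at [p], this step size keeps the ball
   of radius [d] invariant and contracts by 1/2. *)
pose t := d / (2 * (C + 1)); have t0 : 0 < t by rewrite divr_gt0.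
have tC : t * C <= d / 2.
  rewrite /t -mulrA ler_pM2l // ler_pdivrMl //; lra.
have tC1 : t * C <= 1 / 2 by lra.
pose fn (x : 'rV[R]_#|K|) : K -> R := fun k => x ord0 (enum_rank k).
pose rowp : 'rV[R]_#|K| := \row_j p (enum_val j).
pose U := closed_ball_ (fun x => `|x|) rowp d.
pose g (x : 'rV[R]_#|K|) : 'rV[R]_#|K| :=
  \row_j (p (enum_val j) + t * F (enum_val j) (fn x)).
have UP x : U x <-> within_box p d (fn x).
  rewrite /U /closed_ball_ /= row_norm_le ?ltW //; split=> Ux k.
    by have := Ux (enum_rank k); rewrite !mxE enum_rankK distrC.
  by have := Ux (enum_val k); rewrite /fn enum_valK !mxE distrC.
have U1 x : U x -> within_box p 1 (fn x) by move=> /UP Ux k;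
  exact: le_trans (Ux k) d1.
have pp e : 0 <= e -> within_box p e p by move=> e0 k; rewrite subrr normr0.
have gU : set_fun U U g.
  move=> x Ux; apply/UP => k; rewrite /fn mxE enum_rankK addrC addKr.
  rewrite normrM gtr0_norm //; have [_ Lk] := LP k.
  have xp := U1 x Ux; have := Lk p _ 1 (pp _ ler01) xp xp ler01.
  rewrite mulr1 => Fk; apply: (@le_trans _ _ (t * C)); last by lra.
  rewrite ler_pM2l //; apply: le_trans (LC k).
  by rewrite -[F k _](subrK (F k p)) (le_trans (ler_normD _ _)) // lerD2r.
have ctr : is_contraction (mkfun_fun gU).
  exists (2^-1)%:nng; split=> /=; first lra.
  move=> [x y] /= [Ux Uy]; have xy0 : 0 <= `|x - y| by [].
  apply/row_norm_le => [|j]; first by rewrite mulr_ge0.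
  rewrite !mxE opprD addrACA subrr add0r -mulrBr normrM gtr0_norm //.
  have yx : within_box (fn y) `|x - y| (fn x).
    by move=> k; rewrite /fn; have /row_norm_le := lexx `|x - y|;
      move=> /(_ xy0) /(_ (enum_rank k)); rewrite !mxE.
  have [_ Lk] := LP (enum_val j).
  have := Lk _ _ _ (U1 y Uy) (U1 x Ux) yx xy0.
  rewrite -(ler_pM2l t0) => /le_trans; apply; rewrite mulrA ler_wpM2r //.
  apply: le_trans (_ : t * C <= _); last by lra.
  by rewrite ler_pM2l //; apply: le_trans (LC (enum_val j)); rewrite lerDl.
have [|x Ux xg] := banach_fixed_point ctr (@closed_closed_ball_ _ _ rowp d).
  by exists rowp; apply/UP => k; rewrite /fn mxE enum_rankK subrr normr0 ltW.
exists t, (fn x); split=> //; first exact/UP.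
move=> k; have := congr1 (fun y : 'rV_#|K| => y ord0 (enum_rank k)) xg.
by rewrite /= mxE enum_rankK => e; exact: e.
Qed.

End FixedPoint.

(** * Nearby placements with the same lengths *)

Section Flexes.
Variables (R : realType) (H : colored_graph).
Local Notation K := (cvert H * bool)%type.
Implicit Types (f g : cedge H) (A T : {set cedge H}) (v : cvert H).
Implicit Types (p q m : K -> R).
Local Notation B := (@length_form R H).

Lemma length_form_midpoint f p q :
  B f q q - B f p p = 2 * B f (fun k => (p k + q k) / 2) (fun k => q k - p k).
Proof. by rewrite /length_form; lra. Qed.

Lemma length_form_reflect f p m :
  B f (fun k => 2 * m k - p k) (fun k => 2 * m k - p k) =
  B f p p + 4 * B f m (fun k => m k - p k).
Proof. by rewrite /length_form; lra. Qed.

Lemma cardK : #|{: K}| = (2 * #|cvert H|)%N.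
Proof. by rewrite card_prod card_bool mulnC. Qed.

Lemma independent_card T p : (0 < #|cvert H|)%N -> independent T p ->
  (#|T| + 1 <= 2 * #|cvert H|)%N.
Proof.
move=> /card_gt0P[v _] iT; rewrite addnC -[#|cvert H|]cardsT.
apply: (independent_nullity (w := fun _ : 'I_1 => @slide R H) iT (finset.subsetT
  _)).
  by move=> *; exact: length_form_slide.
move=> a a0 i; have := a0 (v, false) (finset.in_setT _).
by rewrite big_ord1 /slide /= mulr1 (ord1 i).
Qed.

Lemma independent_kernel T m (w : K -> R) : independent T m ->
  (#|T| + 1 = 2 * #|cvert H|)%N -> (forall f, f \in T -> B f m w = 0) ->
  exists t, forall k, w k = t * @slide R H k.
Proof.
move=> iT cT w0; apply: contrapT => /forallNP nt.
suff : (2 + #|T| <= 2 * #|[set: cvert H]|)%N by rewrite cardsT; clear - cT; lia.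
pose ww (i : 'I_2) := if i == ord0 then @slide R H else w.
apply: (independent_nullity (w := ww) iT (finset.subsetT _)) => [f i fT|a a0].
  by rewrite /ww; case: ifP => _; [exact: length_form_slide|exact: w0].
have {}a0 k : a ord0 * @slide R H k + a (lift ord0 ord0) * w k = 0.
  by have := a0 k (finset.in_setT _); rewrite !big_ord_recl big_ord0 addr0.
have a1 : a (lift ord0 ord0) = 0.
  apply/eqP; apply: contraT => a1; case: (nt (- a ord0 / a (lift ord0 ord0))) => k.
  apply: (mulfI a1); rewrite mulrA mulrCA mulfV // mulr1 mulNr.
  by apply/eqP; rewrite -addr_eq0 addrC a0.
have /card_gt0P[v _] : (0 < #|cvert H|)%N by clear - cT; lia.
have := a0 (v, false); rewrite a1 mul0r addr0 /slide /= mulr1 => a00 i.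
by case: (unliftP ord0 i) => [j ->|->] //; rewrite (ord1 j).
Qed.

Lemma independent_near T p : independent T p ->
  exists2 d, 0 < d <= 1 & forall q, within_box p d q -> independent T q.
Proof.
move=> /independent_gram gp; have [d d0 gq] := polyfun_nonzero_near (polyfun_gram
  R T) gp.
by exists d => // q /gq; rewrite -independent_gram.
Qed.

(* Since B q q - B p p = 2 B ((p + q) / 2) (q - p), equal lengths make q - p   *)
(* an infinitesimal motion at the midpoint.                                    *)
Lemma rigid_near T p : independent T p -> (#|T| + 1 = 2 * #|cvert H|)%N ->
  exists2 d, 0 < d & forall q, within_box p d q ->
    (forall f, f \in T -> B f q q = B f p p) ->
    exists t, forall k, q k = p k + t * @slide R H k.
Proof.
move=> iT cT; have [d /andP[d0 _] near_d] := independent_near iT.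
exists d => // q pq Bq; pose m k := (p k + q k) / 2.
have im : independent T m.
  apply: near_d => k; rewrite /m (_ : _ - p k = (q k - p k) / 2); last by lra.
  rewrite normrM (@gtr0_norm _ 2^-1) ?invr_gt0 //.
  by have := pq k; have := normr_ge0 (q k - p k); lra.
have [|t tk] := independent_kernel (w := fun k => q k - p k) im cT.
  by move=> f fT; have := length_form_midpoint f p q; rewrite Bq // subrr -/m; lra.
by exists t => k; rewrite -tk addrC subrK.
Qed.

Lemma row_mul_rigidity_mx T p q i :
  ((\row_j q (enum_val j)) *m (rigidity_mx T p)^T) 0 i = B (enum_val i) p q.
Proof.
rewrite mxE length_form_unit [RHS](big_enum_val (A := mem {: K})) /=.
by apply: eq_bigr => j _; rewrite !mxE.
Qed.

(** With the row that pins the abscissa of [v] there are still fewer than 2n rows. Pinning excludes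
    nonzero slides along the mirror. *)
Lemma pinned_motion_exists T p v : (#|T| + 1 < 2 * #|cvert H|)%N ->
  exists w : K -> R, [/\ exists k, w k != 0, w (v, false) = 0 &
    forall f, f \in T -> B f p w = 0].
Proof.
move=> cT; pose M := col_mx (rigidity_mx T p)
  (\row_j (unit_velocity R (v, false) (enum_val j))).
have : kermx M^T != 0.
  rewrite -mxrank_eq0 mxrank_ker -lt0n subn_gt0 mxrank_tr.
  by apply: leq_ltn_trans (rank_leq_row _) _; rewrite cardK.
case/rowV0Pn => x /sub_kermxP xM x0.
pose w k := x 0 (enum_rank k).
have xw : x = \row_j w (enum_val j) by apply/rowP => j; rewrite mxE /w enum_valK.
move: xM; rewrite tr_col_mx mul_mx_row => /eqP.
rewrite -[0 in X in _ == X]row_mx0 => /eqP /eq_row_mx[xT xv].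
exists w; split.
- apply: contrapT => /forallNP w0; case/eqP: x0; apply/rowP => j.
  by rewrite xw !mxE; apply/eqP/negPn/negP => /w0.
- have /rowP/(_ 0) := xv; rewrite !mxE => e; rewrite -[RHS]e.
  rewrite (bigD1 (enum_rank (v, false))) //= big1 ?addr0.
    by rewrite !mxE enum_rankK /unit_velocity eqxx mulr1.
  move=> j jv; rewrite !mxE /unit_velocity.
  case: eqP => [e'|]; last by rewrite mulr0.
  by case/eqP: jv; rewrite -e' enum_valK.
- move=> f fT; have := row_mul_rigidity_mx p w (enum_rank_in fT f).
  by rewrite enum_rankK_in // -xw xT mxE.
Qed.

(* Projecting w along the row space at m, with Cramer's rule for the inverse   *)
(* of the Gram matrix, yields a motion that depends polynomially on m.         *)
Definition motion_field T w m : K -> R := fun k =>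
  gram T m * w k -
  (\row_j w (enum_val j) *m (rigidity_mx T m)^T
     *m \adj (rigidity_mx T m *m (rigidity_mx T m)^T) *m rigidity_mx T m) 0
       (enum_rank k).

Lemma polyfun_motion_field T w k : polyfun (fun m => motion_field T w m k).
Proof.
have pM := @polyfun_rigidity_mx R H T.
have pMT i j : polyfun (fun m : K -> R => (rigidity_mx T m)^T i j).
  by apply: eq_polyfun (pM j i) => m; rewrite [RHS]mxE.
apply: polyfunB.
  by apply: polyfunM; [exact: polyfun_gram|exact: polyfun_const].
apply: polyfun_mulmx => // i j; apply: polyfun_mulmx => {i j}[i j|i j].
  by apply: polyfun_mulmx => // {}i {}j; exact: polyfun_const.
apply: (@eq_polyfun _ _ (fun m : K -> R => (-1) ^+ (j + i) *
   \det (row' j (col' i (rigidity_mx T m *m (rigidity_mx T m)^T))))).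
  by move=> m; rewrite [RHS]mxE.
apply: polyfunM; first exact: polyfun_const.
apply: polyfun_det => i' j'.
apply: (@eq_polyfun _ _ (fun m : K -> R =>
    (rigidity_mx T m *m (rigidity_mx T m)^T) (lift j i') (lift i j'))).
  by move=> m; rewrite [RHS]mxE [RHS]mxE.
exact: polyfun_mulmx.
Qed.

Lemma motion_field_kernel T w m f : f \in T -> B f m (motion_field T w m) = 0.
Proof.
move=> fT; rewrite -(enum_rankK_in fT fT) -row_mul_rigidity_mx.
set M := rigidity_mx T m; pose x := \row_(j < #|{: K}|) w (enum_val j).
have -> : \row_j motion_field T w m (enum_val j) =
    gram T m *: x - x *m M^T *m \adj (M *m M^T) *m M.
  apply/rowP => j; rewrite mxE /motion_field enum_valK -/x -/M [RHS]mxE.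
    by congr (_ + _); rewrite [RHS]mxE // [x _ _]mxE.
rewrite mulmxBl -scalemxAl -!mulmxA mul_adj_mx.
by rewrite mulmxA mul_mx_scalar subrr mxE.
Qed.

Lemma motion_field_at T w p k : (forall f, f \in T -> B f p w = 0) ->
  motion_field T w p k = gram T p * w k.
Proof.
move=> w0; rewrite /motion_field.
rewrite (_ : \row_j w (enum_val j) *m _ = 0) ?mul0mx ?mxE ?subr0 //.
by apply/rowP => i; rewrite row_mul_rigidity_mx w0 ?enum_valP // mxE.
Qed.

Lemma dependent_length_form T f m w : independent T m -> f \notin T ->
  ~ independent (f |: T) m -> (forall g, g \in T -> B g m w = 0) -> B f m w = 0.
Proof.
move=> iT fT niT w0; apply: contrapT => Bf; apply: niT => l lE.
have lf : l f = 0.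
  have := lE w; rewrite big_setU1 //= big1 => [|g gT]; last by rewrite w0 ?mulr0.
  by rewrite addr0 => /eqP; rewrite mulf_eq0 => /orP[/eqP //|/eqP].
move=> g /setU1P[-> //|]; apply: iT => q.
by rewrite -[RHS](lE q) big_setU1 //= lf mul0r add0r.
Qed.

(** The field [F] is a motion of [T] at every point, corrected by a slide to keep the abscissa of
    [v]. If m = p + t F(m), then reflecting [p] in [m] changes each length form by 4 t B(m, F(m)) =
    0. Rows of [A] outside [T] depend on those of [T] at every point where [T] is independent, in
    particular at [m], so they are preserved too. *)
Lemma flexible_near T A p v e : T \subset A -> independent T p ->
  (#|T| + 1 < 2 * #|cvert H|)%N ->
  (forall f m, f \in A -> f \notin T -> ~ independent (f |: T) m) -> 0 < e ->
  exists q, [/\ within_box p e q, exists k, q k != p k, q (v, false) = p (v,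
    false) &
    forall f, f \in A -> B f q q = B f p p].
Proof.
move=> TA iT cT maxT e0; have [w [[k0 wk0] wv w0]] := pinned_motion_exists p v cT.
pose F k m := motion_field T w m k - motion_field T w m (v, false) * @slide R H k.
have pF k : polyfun (F k).
  apply: polyfunB; first exact: polyfun_motion_field.
  by apply: polyfunM; [exact: polyfun_motion_field|exact: polyfun_const].
have Fp k : F k p = gram T p * w k.
  by rewrite /F !motion_field_at // wv mulr0 mul0r subr0.
have Fp0 : F k0 p != 0.
  by rewrite Fp mulf_neq0 //; apply/independent_gram.
have [d1 /andP[d10 _] Fnear] := polyfun_nonzero_near (pF k0) Fp0.
have [d2 /andP[d20 _] inear] := independent_near iT.
(* The bound e / 2 is there since q - p = 2 (m - p); within [d1] the field stays nonzero at [k0],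
   within [d2] the set [T] stays independent. *)
pose d := Num.min 1 (Num.min (e / 2) (Num.min d1 d2)).
have d_gt0 : 0 < d <= 1 by rewrite !lt_min ltr01 d10 d20 divr_gt0 //= ge_min lexx.
have [t [m [t0 pm mE]]] := polyfun_fixed_point p pF d_gt0.
have dm x : d <= x -> within_box p x m by move=> dx k; exact: le_trans (pm k) dx.
have m1 : F k0 m != 0 by apply/Fnear/dm; rewrite !ge_min lexx !orbT.
have im : independent T m by apply/inear/dm; rewrite !ge_min lexx !orbT.
have me : within_box p (e / 2) m by apply/dm; rewrite !ge_min lexx !orbT.
exists (fun k => 2 * m k - p k); split.
- move=> k; rewrite (_ : _ - p k = 2 * (m k - p k)); last by lra.
  by rewrite normrM gtr0_norm // mulrC -ler_pdivlMr.
- exists k0; rewrite -subr_eq0 (_ : _ - p k0 = 2 * (t * F k0 m)).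
    by apply: mulf_neq0; [rewrite pnatr_eq0|apply: mulf_neq0 => //; rewrite gt_eqF].
  by rewrite mE; lra.
- by rewrite mE /F /slide /= mulr1 subrr mulr0 addr0; lra.
have BT f : f \in T -> B f m (F^~ m) = 0.
  move=> fT; rewrite (_ : F^~ m = fun k => motion_field T w m k +
     (- motion_field T w m (v, false)) * @slide R H k); last first.
    by apply/funext => k; rewrite /F mulNr.
  by rewrite length_formDr length_formZr motion_field_kernel // length_form_slide
    mulr0 addr0.
move=> f fA; rewrite length_form_reflect.
rewrite (_ : (fun k => m k - p k) = fun k => t * F k m); last first.
  by apply/funext => k; rewrite [in LHS]mE addrC addKr.
rewrite length_formZr (_ : B f m _ = 0) ?mulr0 ?addr0 //.
have [fT|fT] := boolP (f \in T); first exact: BT.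
exact: (dependent_length_form im fT (maxT _ _ fA fT) BT).
Qed.

End Flexes.

(** * Generic placements *)

Section GenericPlacements.
Variables (R : realType) (H : colored_graph).
Local Notation K := (cvert H * bool)%type.
Implicit Types (f g : cedge H) (A T : {set cedge H}) (v : cvert H).
Implicit Types (p q m : K -> R).
Local Notation B := (@length_form R H).

Definition generic p := forall T, (exists q, independent T q) -> independent T p.

Definition full_rank A p := exists T,
  [/\ T \subset A, independent T p & (#|T| + 1 = 2 * #|cvert H|)%N].

Lemma generic_flexible A p v e : generic p -> ~ full_rank A p -> 0 < e ->
  exists q, [/\ within_box p e q, exists k, q k != p k, q (v, false) = p (v,
    false) &
    forall f, f \in A -> B f q q = B f p p].
Proof.
move=> gp nA e0; pose P (T : {set cedge H}) := (T \subset A) && `[< independent T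
  p >].
have P0 : P finset.set0.
  by rewrite /P finset.sub0set; apply/asboolP => l _ f; rewrite inE.
have [T /andP[TA /asboolP iT] maxT] : exists2 T, P T & forall T', P T' -> (#|T'|
  <= #|T|)%N.
  by case: (@arg_maxnP _ finset.set0 P (fun T : {set _} => #|T|) P0) => T; exists T.
have v0 : (0 < #|cvert H|)%N by apply/card_gt0P; exists v.
have cT : (#|T| + 1 < 2 * #|cvert H|)%N.
  rewrite ltn_neqAle (independent_card v0 iT) andbT; apply/eqP => cT.
  by apply: nA; exists T.
apply: (flexible_near v TA iT cT _ e0) => f m fA fT im.
have : P (f |: T)%SET.
  rewrite /P finset.subUset finset.sub1set fA TA; apply/asboolP; apply: gp.
  by exists m.
by move/maxT; rewrite cardsU1 fT; clear; lia.
Qed.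

(** If every deletion destroys full rank, an independent set of size 2n - 1 contains every edge.
    Conversely, deleting one of 2n - 1 edges leaves too few. *)
Lemma generic_minimal p : (0 < #|cvert H|)%N -> generic p ->
  (full_rank [set: cedge H]%SET p /\ forall f, ~ full_rank (~: [set f])%SET p) <->
  reflection_laman H.
Proof.
move=> n0 gp; rewrite /reflection_laman laman_count_sparse.
have cE : (#|cedge H|%:Z = 2 * #|cvert H|%:Z - 1) <-> (#|cedge H| + 1 = 2 *
  #|cvert H|)%N.
  by split; lia.
rewrite cE; split=> [[[T [_ iT cT]] minT]|[cT sE]].
  have TE : T = [set: cedge H]%SET.
    apply/eqP; rewrite finset.eqEsubset finset.subsetT;
      apply/fintype.subsetP => f _.
    apply: contraT => fT; case: (minT f); exists T; split=> //.
    by rewrite finset.subsetC finset.sub1set inE.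
  by rewrite -cardsT -TE cT; split=> //; exact: independent_sparse iT.
have iE : independent [set: cedge H]%SET p by apply: gp; exact: sparse_independent.
split=> [|f [T [Tf _ cT']]]; first by exists [set: cedge H]%SET; rewrite cardsT.
have := subset_leq_card Tf; rewrite cardsC1.
by clear - cT cT'; lia.
Qed.

Definition gram_product p : R :=
  \prod_(T : {set cedge H} | `[< exists q, independent (R := R) T q >]) gram T p.

Lemma gram_product_generic p : gram_product p != 0 -> generic p.
Proof.
move=> gp T iT; apply/independent_gram; apply: contraNneq gp => T0.
apply/prodf_eq0; exists T; last exact/eqP.
exact/asboolP.
Qed.

Lemma polyfun_gram_product : polyfun gram_product.
Proof. by apply: polyfun_prod => T; exact: polyfun_gram. Qed.

Lemma gram_product_neq0 : exists p, gram_product p != 0.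
Proof.
rewrite /gram_product; elim: (index_enum _) => [|T s [p IH]].
  by exists (fun=> 0); rewrite big_nil oner_eq0.
case: (asboolP (exists q, independent (R := R) T q)) => [[q /independent_gram
  qT]|nT].
  have pP : polyfun (fun p => \prod_(T <- s | `[< exists q, independent (R := R)
    T q >]) gram T p).
    by apply: polyfun_prod => ?; exact: polyfun_gram.
  have [r [r1 r2]] := polyfun_common_nonzero (polyfun_gram R T) pP qT IH.
  by exists r; rewrite big_cons; case: ifP => // _; rewrite mulf_neq0.
exists p; rewrite big_cons; case: asboolP => //.
Qed.

Lemma generic_length_neq0 p f : generic p -> (exists q, independent [set f]%SET
  q) ->
  0 < B f p p.
Proof.
move=> gp /gp if_; have [q] := independent_length_form_neq0 if_ (set11 f).
apply: contraNlt; rewrite /length_form -!expr2 => le0.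
have := sqr_ge0 (p (tgt f, false) - p (src f, false)).
have := sqr_ge0 (p (tgt f, true) - sgn R (color f) * p (src f, true)) => y0 x0.
have /eqP : (p (tgt f, false) - p (src f, false)) ^+ 2 = 0 by lra.
have /eqP : (p (tgt f, true) - sgn R (color f) * p (src f, true)) ^+ 2 = 0 by lra.
by rewrite !sqrf_eq0 => /eqP -> /eqP ->; rewrite !mul0r addr0.
Qed.

Lemma single_edge_independent f : (src f = tgt f -> color f != 0) ->
  exists q : K -> R, independent [set f]%SET q.
Proof.
move=> ff; suff [q Bq] : exists q : K -> R, B f q q != 0.
  exists q => l lE g /set1P ->; have := lE q; rewrite big_set1 => /eqP.
  by rewrite mulf_eq0 (negPf Bq) orbF => /eqP.
have [st|st] := eqVneq (src f) (tgt f); last first.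
  exists (unit_velocity R (tgt f, false)).
  rewrite /length_form /unit_velocity eqxx !xpair_eqE (negPf st) /= !andbF.
  by rewrite mulr0n mulr1n !mulr0 !subr0 mulr1 mulr0 addr0 oner_eq0.
exists (unit_velocity R (tgt f, true)).
rewrite /length_form /unit_velocity -st eqxx !xpair_eqE /= !andbF /sgn (negPf (ff
  st)).
by rewrite mulr0n mulr1n; apply/eqP; lra.
Qed.

End GenericPlacements.

(** * Realizations and the configuration space *)

Section PlaneFrame.
Variables (R : realType) (u : 'rV[R]_2).
Implicit Types (x y : 'rV[R]_2) (h : 'rV[R]_2 -> 'rV[R]_2).
Local Notation o1 := (lift ord0 ord0 : 'I_2).

Lemma dotE x y : dot x y = x ord0 ord0 * y ord0 ord0 + x ord0 o1 * y ord0 o1.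
Proof. by rewrite /dot !big_ord_recl big_ord0 addr0. Qed.

Lemma dot_ge0 x : 0 <= dot x x.
Proof. by rewrite dotE -!expr2 addr_ge0 ?sqr_ge0. Qed.

Lemma enorm_sqr x : enorm x ^+ 2 = dot x x.
Proof. by rewrite sqr_sqrtr ?dot_ge0. Qed.

Lemma row2P x y : x ord0 ord0 = y ord0 ord0 -> x ord0 o1 = y ord0 o1 -> x = y.
Proof.
move=> e0 e1; apply/rowP => j; case: (unliftP ord0 j) => [k ->|-> //].
by rewrite (ord1 k).
Qed.

Lemma dot_eq0 x : dot x x = 0 -> x = 0.
Proof.
rewrite dotE -!expr2 => /eqP; rewrite paddr_eq0 ?sqr_ge0 // !sqrf_eq0.
by case/andP=> /eqP x0 /eqP x1; apply: row2P; rewrite mxE.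
Qed.

Definition perp : 'rV[R]_2 :=
  \row_j (if j == ord0 then - u ord0 o1 else u ord0 ord0).

(** The frame is not normalized: squared lengths acquire the factor [dot u u] ([dot_frame]). *)
Definition frame x (b : bool) : R := if b then dot x perp else dot x u.

Lemma frameB x y b : frame (x - y) b = frame x b - frame y b.
Proof. by case: b; rewrite /frame !dotE !mxE /=; lra. Qed.

Lemma frameD x y b : frame (x + y) b = frame x b + frame y b.
Proof. by case: b; rewrite /frame !dotE !mxE /=; lra. Qed.

Lemma frameZ a x b : frame (a *: x) b = a * frame x b.
Proof. by case: b; rewrite /frame !dotE !mxE /=; lra. Qed.

Lemma frame_u b : frame u b = if b then 0 else dot u u.
Proof. by case: b; rewrite /frame // !dotE !mxE /=; lra. Qed.

Lemma frame_perp b : frame perp b = if b then dot u u else 0.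
Proof. by case: b; rewrite /frame // !dotE !mxE /=; lra. Qed.

Lemma dot_frame x : dot x x * dot u u = frame x false ^+ 2 + frame x true ^+ 2.
Proof. by rewrite /frame !dotE !mxE /= !expr2; lra. Qed.

Hypothesis u_neq0 : u != 0.

Lemma dot_u_gt0 : 0 < dot u u.
Proof.
rewrite lt_neqAle dot_ge0 andbT eq_sym; apply: contraNneq u_neq0 => /dot_eq0 ->.
by [].
Qed.

Lemma frame_inj x y : (forall b, frame x b = frame y b) -> x = y.
Proof.
move=> xy; apply/subr0_eq/dot_eq0; have := dot_frame (x - y).
rewrite !frameB !xy !subrr expr0n /= addr0 => /eqP.
by rewrite mulf_eq0 (gt_eqF dot_u_gt0) orbF => /eqP.
Qed.

Definition of_frame (a b : R) : 'rV[R]_2 := (dot u u)^-1 *: (a *: u + b *: perp).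

Lemma of_frameK a b c : frame (of_frame a b) c = if c then b else a.
Proof.
rewrite /of_frame frameZ frameD !frameZ frame_u frame_perp.
by case: c; rewrite mulr0 ?add0r ?addr0 mulrC mulfK // gt_eqF ?dot_u_gt0.
Qed.

Lemma frame_gact g x b : frame (Defs.gact u g x) b = (if b then sgn R g else 1) *
  frame x b.
Proof.
rewrite /Defs.gact /sgn; case: eqP => _; first by case: b; rewrite mul1r.
rewrite /reflection frameB frameZ frame_u.
case: b; rewrite ?mulr0 ?mul1r; first by rewrite sub0r mulN1r.
rewrite -mulrA mulVf ?mulr1 ?gt_eqF ?dot_u_gt0 // /frame; lra.
Qed.

Lemma gactD g k x : Defs.gact u (g + k) x = Defs.gact u k (Defs.gact u g x).
Proof.
by apply: frame_inj => b; rewrite !frame_gact; case: b;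
  rewrite ?mul1r // sgnD mulrA [sgn R g * _]mulrC.
Qed.

Lemma gact_translate g x t : Defs.gact u g (x + t *: u) = Defs.gact u g x + t *: u.
Proof.
apply: frame_inj => b; rewrite frame_gact !frameD frame_gact frameZ frame_u.
by case: b; rewrite ?mul1r // mulr0 !addr0.
Qed.

Lemma translate_Cent t : Cent u (fun x => x + t *: u).
Proof.
split; first split.
- by exists (fun x => x - t *: u) => x; rewrite ?addrK ?subrK.
- by move=> x y; rewrite opprD addrACA subrr addr0.
- by move=> g x; rewrite gact_translate.
Qed.

(* An isometry commuting with the reflection preserves the distance to the     *)
(* mirror, as it preserves the distance of a point to its mirror image.        *)
Lemma Cent_height h x : Cent u h -> frame (h x) true ^+ 2 = frame x true ^+ 2.
Proof.
move=> [[_ iso] com]; have := iso x (Defs.gact u 1 x); rewrite com.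
have dist y : dot (y - Defs.gact u 1 y) (y - Defs.gact u 1 y) * dot u u = 4 *
  frame y true ^+ 2.
  by rewrite dot_frame !(frameB y (Defs.gact u 1 y)) !frame_gact /sgn /= !expr2;
    lra.
move=> /(congr1 (fun a => a ^+ 2)); rewrite !enorm_sqr.
by move=> /(congr1 (fun a => a * dot u u)); rewrite !dist; lra.
Qed.

Lemma Cent_dist h x y : Cent u h ->
  (frame (h x) false - frame (h y) false) ^+ 2 + (frame (h x) true - frame (h y)
    true) ^+ 2 =
  (frame x false - frame y false) ^+ 2 + (frame x true - frame y true) ^+ 2.
Proof.
move=> [[_ iso] _]; have /(congr1 (fun a => a ^+ 2)) := iso x y.
by rewrite !enorm_sqr => /(congr1 (fun a => a * dot u u));
  rewrite !dot_frame !frameB.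
Qed.

Lemma sqr_entry_le x j : x ord0 j ^+ 2 <= dot x x.
Proof.
rewrite dotE -!expr2; have := sqr_ge0 (x ord0 ord0); have := sqr_ge0 (x ord0 o1).
by case: (unliftP ord0 j) => [k ->|->]; rewrite ?(ord1 k) ?lerDl ?lerDr.
Qed.

End PlaneFrame.

(** * Symmetric realizations as placements of the quotient *)

Section Realizations.
Variables (R : realType) (u : 'rV[R]_2) (u_neq0 : u != 0).
Variables (G : multigraph) (phi : free_action G) (Q : colored_quotient phi).
Local Notation V := (orbit_type (vact phi)).
Local Notation H := (quotient_graph Q).
Implicit Types (p : qplacement R phi) (P : placement R G).

Definition frame_coords p : cvert H * bool -> R := fun k => frame u (p k.1) k.2.

Definition restriction P : qplacement R phi := fun w => P (rep Q w).

Definition equivariant P := forall g i, P (vact phi i g) = Defs.gact u g (P i).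

Lemma vactD v g k : vact phi (vact phi v g) k = vact phi v (g + k).
Proof. by rewrite -actM. Qed.

Lemma vertex_rep v : exists g, v = vact phi (rep Q (orbit_of (vact phi) v)) g.
Proof.
have := rep_mem Q (orbit_of (vact phi) v); rewrite /= => /orbitP[g _ <-].
exists (- g); rewrite vactD subrr; exact/esym/act1.
Qed.

Lemma edge_ends e : exists g,
  ends e = [set vact phi (rep Q (qsrc Q (orbit_of (eact phi) e))) g;
    vact phi (rep Q (qtgt Q (orbit_of (eact phi) e))) (g + qcolor Q (orbit_of
      (eact phi) e))]%SET.
Proof.
have [e0 e0f endsE] := quotientP Q (orbit_of (eact phi) e).
have : e \in orbit (eact phi) [set: 'Z_2]%SET e0 by rewrite orbit_sym.
by case/orbitP => g _ eg; exists g; rewrite -{1}eg endsE.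
Qed.

Lemma sym_placement_equivariant p : equivariant (sym_placement u Q p).
Proof.
move=> g i; have [k ->] := vertex_rep i.
by rewrite vactD !sym_placementE gactD.
Qed.

Lemma restriction_sym_placement p : restriction (sym_placement u Q p) = p.
Proof.
apply/funext => w; rewrite /restriction.
have := sym_placementE u Q p w 0; rewrite /Defs.gact eqxx => <-.
by congr sym_placement; exact/esym/act1.
Qed.

Lemma set2_ends (T : finType) (a b i j : T) : #|[set a; b]%SET| = 2%N ->
  [set a; b]%SET = [set i; j]%SET -> (i = a /\ j = b) \/ (i = b /\ j = a).
Proof.
rewrite cards2 => ab abij; have {}ab : a != b by case: eqP ab.
have: i \in [set a; b]%SET by rewrite abij set21.
have: j \in [set a; b]%SET by rewrite abij set22.
have: a \in [set i; j]%SET by rewrite -abij set21.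
have: b \in [set i; j]%SET by rewrite -abij set22.
rewrite !inE => bij aij jab iab.
case/orP: iab => /eqP ?; case/orP: jab => /eqP ?; subst i j; [|by left|by right|].
  by move: bij; rewrite orbb eq_sym (negPf ab).
by move: aij; rewrite orbb (negPf ab).
Qed.

(** By equivariance, applying the group element that aligns [e] with its representative only changes
    the sign across the mirror, which squaring forgets. *)
Lemma length_form_enorm P e i j : equivariant P -> ends e = [set i; j]%SET ->
  enorm (P j - P i) ^+ 2 * dot u u =
  length_form (H := H) (orbit_of (eact phi) e)
    (frame_coords (restriction P)) (frame_coords (restriction P)).
Proof.
move=> eP eij; have [g endsE] := edge_ends e.
set f := orbit_of _ e in endsE *.
set a := vact phi _ g in endsE; set b := vact phi _ _ in endsE.
have ab : enorm (P b - P a) ^+ 2 * dot u u = length_form (H := H) f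
    (frame_coords (restriction P)) (frame_coords (restriction P)).
  rewrite enorm_sqr dot_frame !frameB /a /b !eP !frame_gact // !mul1r sgnD.
  rewrite /length_form /frame_coords /restriction /= -!expr2; congr (_ + _).
  rewrite -mulrA -mulrBr exprMn [X in X * _]expr2 sgn_sqr mul1r.
  have := sgn_sqr R (qcolor Q f); set s := sgn R _ => ss.
  set yt := dot _ _; set ys := dot _ _.
  rewrite (_ : (s * yt - ys) = s * (yt - s * ys) - (1 - s * s) * ys); last by lra.
  by rewrite ss subrr mul0r subr0 exprMn [X in X * _]expr2 ss mul1r.
have := loopless e; rewrite endsE => ab2.
have [[-> ->] //|[-> ->]] := set2_ends ab2 (etrans (esym endsE) eij).
by rewrite -ab !enorm_sqr; congr (_ * _); rewrite !dotE !mxE; lra.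
Qed.

Definition induced_length p e : R :=
  Num.sqrt (length_form (H := H) (orbit_of (eact phi) e) (frame_coords p)
    (frame_coords p)
            / dot u u).

Definition edges_over (T : {set cedge H}) : {set edge G} :=
  [set e | orbit_of (eact phi) e \in T].

Lemma length_form_ge0 (K : colored_graph) f (p : cvert K * bool -> R) : 0 <=
  length_form f p p.
Proof. by rewrite /length_form -!expr2 addr_ge0 ?sqr_ge0. Qed.

Lemma orbit_witness (f : orbit_type (eact phi)) : exists e, orbit_of (eact phi) e
  = f.
Proof.
have [e ef _] := quotientP Q f; exists e; exact: orbit_of_eq.
Qed.

Lemma realizationsP p T P :
  realizations u phi (induced_length p) (edges_over T) P <->
  equivariant P /\ forall f, f \in T ->
    length_form (H := H) f (frame_coords (restriction P)) (frame_coords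
      (restriction P)) =
    length_form (H := H) f (frame_coords p) (frame_coords p).
Proof.
have uu := dot_u_gt0 u_neq0.
have lE e : induced_length p e ^+ 2 * dot u u =
    length_form (H := H) (orbit_of (eact phi) e) (frame_coords p) (frame_coords p).
  rewrite sqr_sqrtr ?divfK ?gt_eqF //.
  by rewrite divr_ge0 ?length_form_ge0 // ltW.
split=> [[PE eP]|[eP PE]]; split=> //.
- move=> f fT; have [e ef] := orbit_witness f; have [g endsE] := edge_ends e.
  have eT : e \in edges_over T by rewrite inE ef.
  by rewrite -ef -(length_form_enorm eP endsE) -lE; congr (_ * _); exact: PE.
- move=> e i j; rewrite inE => eT eij.
  apply: (mulIf (negbT (gt_eqF uu))).
  by rewrite (length_form_enorm eP eij) PE // lE.
Qed.

Lemma sym_placement_realization p T :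
  realizations u phi (induced_length p) (edges_over T) (sym_placement u Q p).
Proof.
apply/realizationsP; split; first exact: sym_placement_equivariant.
by move=> f _; rewrite restriction_sym_placement.
Qed.

Lemma edges_over_setT : edges_over [set: cedge H]%SET = [set: edge G]%SET.
Proof. by apply/setP => e; rewrite !inE. Qed.

Lemma edges_over_setC e :
  edges_over (~: [set orbit_of (eact phi) e])%SET =
  (~: orbit (eact phi) [set: 'Z_2]%SET e)%SET.
Proof.
apply/setP => e'; rewrite [LHS]inE !finset.in_setC finset.in_set1; congr (~~ _).
apply/eqP/idP => [ee|]; last by move=> e'e;
  apply: (@orbit_of_eq _ (eact phi) (orbit_of (eact phi) e)).
by have /= <- := congr1 val ee; exact: orbit_refl.
Qed.

Lemma quotient_loop_color (f : cedge H) : src f = tgt f -> color f != 0.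
Proof.
move=> /= st; have [e _ /(_ 0)] := quotientP Q f; rewrite -st add0r => endsE.
have := loopless (eact phi e 0); rewrite endsE; apply: contra_eqN => /eqP ->.
by rewrite finset.setUid cards1.
Qed.

Lemma induced_length_gt0 p e : generic (H := H) (frame_coords p) -> 0 <
  induced_length p e.
Proof.
move=> gp; rewrite sqrtr_gt0 divr_gt0 ?dot_u_gt0 //.
apply: generic_length_neq0 => //; apply: single_edge_independent.
exact: quotient_loop_color.
Qed.

Lemma polyfun_mpoly (f : (cvert H * bool -> R) -> R) : polyfun f ->
  exists F, forall p, mpoly.meval (coords p) F = f (frame_coords p).
Proof.
elim=> [c|[w b]|{}f g _ [F FE] _ [F' F'E]|{}f g _ [F FE] _ [F' F'E]].
- by exists (mpoly.mpolyC _ c) => p; rewrite mpoly.mevalC.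
- pose X j := mpoly.mpolyX R (mpoly.mnm1 (enum_rank (w, j : 'I_2))).
  have XE j p : mpoly.meval (coords p) (X j) = p w ord0 j.
    by rewrite mpoly.mevalXU /coords enum_rankK.
  pose d := if b then perp u else u.
  exists (\sum_j X j * mpoly.mpolyC _ (d ord0 j)) => p.
  rewrite raddf_sum /frame_coords /frame /= (_ : (if b then _ else _) = dot (p w)
    d).
    by apply: eq_bigr => j _; rewrite rmorphM /= XE mpoly.mevalC.
  by rewrite /d; case: (b).
- by exists (F + F') => p; rewrite rmorphD /= FE F'E.
- by exists (F * F') => p; rewrite rmorphM /= FE F'E.
Qed.

Lemma frame_coords_surj (q : cvert H * bool -> R) : exists p, frame_coords p = q.
Proof.
exists (fun w => of_frame u (q (w, false)) (q (w, true))).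
by apply/funext => -[w b]; rewrite /frame_coords of_frameK //=; case: b.
Qed.

End Realizations.

Local Open Scope classical_set_scope.

(** * Isolated points of the configuration space *)

Section Topology.
Variables (R : realType) (u : 'rV[R]_2).
Variables (G : multigraph) (phi : free_action G).
Implicit Types (P : placement R G).

Lemma placement_ball_nbhs P (d : R) : 0 < d ->
  nbhs P [set P' : placement R G | forall i, `|P' i - P i| < d].
Proof.
move=> d0; apply: (@filter_forall (placement R G) (vert G)
  (fun i P' => `|P' i - P i| < d) (nbhs P) _) => i.
have ci := @proj_continuous (vert G) (fun=> 'rV[R]_2) i P.
have Pd : nbhs P (fun P' : placement R G => ball (P i) d (P' i)).
  exact: (ci _ (nbhsx_ballx _ _ d0)).
by apply: filterS Pd => P'; rewrite -ball_normE /= distrC.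
Qed.

Lemma placement_nbhs_ball P (O : set (placement R G)) : nbhs P O ->
  exists2 d : R, 0 < d & forall P', (forall i, `|P' i - P i| < d) -> O P'.
Proof.
pose F := filter_from [set d : R | 0 < d]
  (fun d => [set P' : placement R G | forall i, `|P' i - P i| < d]).
suff FP : {ptws, F --> P} by move=> /FP.
have FF : Filter F.
  apply: filter_from_filter; first by exists 1; rewrite /=.
  move=> d e /= d0 e0; exists (Num.min d e); first by rewrite /= lt_min d0.
  by move=> P' /= P'd; split=> i; have := P'd i; rewrite lt_min => /andP[].
apply/cvg_sup => i A [_ [[W oW <-] /= WP sWA]].
have : nbhs (P i) W by exact: open_nbhs_nbhs.
move=> /nbhs_ballP[d /= d0 dW]; exists d => //= P' P'd.
apply: sWA; apply: dW; rewrite -ball_normE /= distrC; exact: P'd.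
Qed.

Variables (l : edge G -> R) (A : {set edge G}).
Local Notation realz := (realizations u phi l A).

Lemma realization_nbhs (x : realz) (S : set realz) : nbhs x S ->
  exists2 O, nbhs (set_val x : placement R G) O & forall y : realz, O (set_val y)
    -> S y.
Proof.
move=> [_ [[W oW <-] /= Wx sWS]]; exists W; first exact: open_nbhs_nbhs.
by move=> y Wy; apply: sWS.
Qed.

Lemma configE (x y : realz) : config x = config y <-> congruent x y.
Proof. by split=> [/eqmodP|xy]; last exact/eqmodP. Qed.

(** A point of the quotient is isolated when its class is open among realizations, so a ball is
    required around each member [y] of the class and not only around [x]. *)
Lemma isolated_config (x : realz) :
  (forall y : realz, congruent y x -> exists2 d : R, 0 < d & forall z : realz,
     (forall i, `|set_val z i - set_val y i| < d) -> congruent z x) ->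
  isolated [set: config_space u phi l A] (config x).
Proof.
move=> near_x; split; first by rewrite inE.
exists [set config x]; last by rewrite setIT.
have op : open [set config x].
  rewrite /open /= /quotient_open openE => y /= yx.
  have {}yx : congruent y x by apply/configE.
  have [d d0 zd] := near_x y yx; rewrite /interior.
  have cv := @initial_continuous _ _ (set_val : realz -> placement R G) y.
  have Ny : nbhs y (fun z : realz => forall i, `|set_val z i - set_val y i| < d).
    exact: (cv _ (placement_ball_nbhs (set_val y) d0)).
  by apply: filterS Ny => z zy /=; apply/configE; exact: zd.
by apply: open_nbhs_nbhs; split.
Qed.

Lemma isolated_config_near (x : realz) :
  isolated [set: config_space u phi l A] (config x) ->
  exists2 d : R, 0 < d & forall z : realz,
    (forall i, `|set_val z i - set_val x i| < d) -> congruent x z.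
Proof.
move=> [_ [W Wx]]; rewrite setIT => WE.
have : nbhs x ((fun z => config z) @^-1` W) by exact: (@pi_continuous _ _ x).
case/realization_nbhs => O /placement_nbhs_ball[d d0 dO] OW.
exists d => // z /dO /OW /=; rewrite WE /= => zx.
by apply/configE.
Qed.

End Topology.

Lemma normr_le_sqr (R : realDomainType) (c e : R) : 0 <= e ->
  (`|c| <= e) = (c ^+ 2 <= e ^+ 2).
Proof. by move=> e0; rewrite -[c ^+ 2]real_normK ?num_real // ler_sqr ?nnegrE. Qed.

Lemma normr_lt_sqr (R : realDomainType) (c e : R) : 0 <= e ->
  (`|c| < e) = (c ^+ 2 < e ^+ 2).
Proof. by move=> e0; rewrite -[c ^+ 2]real_normK ?num_real // ltr_sqr ?nnegrE. Qed.

(** * Rigidity and full rank *)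

Section RigidityCriterion.
Variables (R : realType) (u : 'rV[R]_2) (u_neq0 : u != 0).
Variables (G : multigraph) (phi : free_action G) (Q : colored_quotient phi).
Local Notation H := (quotient_graph Q).
Local Notation K := (cvert H * bool)%type.
Variables (p : qplacement R phi) (T : {set cedge H}).
Local Notation X := (frame_coords (Q := Q) u p : K -> R).
Local Notation l := (induced_length u Q p).
Local Notation A := (edges_over T).
Local Notation realz := (realizations u phi l A).

Lemma realization_val (P : placement R G) : realizations u phi l A P ->
  exists x : realz, set_val x = P.
Proof. by move=> rP; exists (exist _ P (mem_set rP)); rewrite set_valE. Qed.

Lemma Cent_realization h P : Cent u h -> realizations u phi l A P ->
  realizations u phi l A (h \o P).
Proof.
move=> [[_ iso] com] [lP eP]; split=> [e i j eA eij|g i] /=.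
  by rewrite iso; exact: lP.
by rewrite eP com.
Qed.

(** The isometry [k] that takes [y] to [x] carries a realization [z] near [y] to one near [x]. By
    [rigid_near] the latter is a slide of [x], so [z] is congruent to [x]. *)
Lemma full_rank_rigid : full_rank T X -> rigid u phi l A (sym_placement u Q p).
Proof.
case=> T0 [T0T iT0 cT0]; have [d d0 rig] := rigid_near iT0 cT0.
have a0 := dot_u_gt0 u_neq0; set a := dot u u in a0.
have [x xP] := realization_val (sym_placement_realization u_neq0 p T).
exists x; split=> //; apply: isolated_config => y /asboolP[k kC yx].
have ad : 0 < 1 + 2 * a by lra.
(* A vector of max norm at most e has frame coordinates whose squares are at most 2 a e^2, and 2 a
   is at most (1 + 2 a)^2. *)
exists (d / (1 + 2 * a)) => [|z zy]; first by rewrite divr_gt0.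
have rx : realizations u phi l A (set_val x) := set_valP x.
have rq := Cent_realization kC (set_valP z : realizations u phi l A (set_val z)).
set q := k \o set_val z in rq.
have [eq Bq] := (realizationsP u_neq0 _ _ _).1 rq.
have [ex _] := (realizationsP u_neq0 _ _ _).1 rx.
have [_ isok] := kC.1.
have near_q i b : `|frame u (q i - set_val x i) b| <= d.
  rewrite (normr_le_sqr _ (ltW d0)).
  apply: (@le_trans _ _ (dot (q i - set_val x i) (q i - set_val x i) * a)).
    rewrite dot_frame; have := sqr_ge0 (frame u (q i - set_val x i) true).
    have := sqr_ge0 (frame u (q i - set_val x i) false).
    by case: b; rewrite ?lerDl ?lerDr.
  have -> : dot (q i - set_val x i) (q i - set_val x i) =
      dot (set_val z i - set_val y i) (set_val z i - set_val y i).
    by rewrite -!enorm_sqr yx /q /= isok.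
  set w := set_val z i - _; set e := d / (1 + 2 * a) in zy.
  have we j : w ord0 j ^+ 2 <= e ^+ 2.
    have e0 : 0 < e by rewrite divr_gt0.
    have : `|w ord0 j| <= e.
      by have /row_norm_le := ltW (zy i); apply; exact: ltW.
    by rewrite (normr_le_sqr _ (ltW e0)).
  apply: (@le_trans _ _ (2 * e ^+ 2 * a)).
    rewrite (ler_wpM2r (ltW a0)) // dotE -!expr2.
    by have := we ord0; have := we (lift ord0 ord0); lra.
  have -> : d = e * (1 + 2 * a) by rewrite /e divfK // gt_eqF.
  have -> : 2 * e ^+ 2 * a = e ^+ 2 * (2 * a) by lra.
  have -> : (e * (1 + 2 * a)) ^+ 2 = e ^+ 2 * (1 + 2 * a) ^+ 2 by lra.
  apply: ler_wpM2l; [exact: sqr_ge0|rewrite expr2].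
  by have := mulr_ge0 (ltW a0) (ltW a0); lra.
have [|t tq] := rig (frame_coords (Q := Q) u (restriction Q q)) _ (fun f fT => Bq
  f (fintype.subsetP T0T f fT)).
  move=> [w b] /=; rewrite /frame_coords /restriction /= -frameB.
  by have := near_q (rep Q w) b; rewrite xP -{2}(restriction_sym_placement u Q p).
pose s := t / a.
have rep_q w : q (rep Q w) = set_val x (rep Q w) + s *: u.
  apply: (frame_inj u_neq0) => b; have := tq (w, b).
  rewrite /frame_coords /restriction /slide /= => ->.
  rewrite frameD frameZ frame_u xP -{1}(restriction_sym_placement u Q p).
  by congr (_ + _); case: b; rewrite ?mulr0 // mulr1 /s divfK // gt_eqF.
have all_q i : q i = set_val x i + s *: u.
  have [g ->] := vertex_rep Q i.
  by rewrite eq ex rep_q gact_translate.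
apply/asboolP; exists ((fun v => v + (- s) *: u) \o k).
  by apply: Cent_comp => //; exact: translate_Cent.
by move=> i; rewrite /= -[k _]/(q i) all_q scaleNr addrK.
Qed.

(** Without full rank there is a different placement [q], arbitrarily near, with the same lengths
    and the same abscissa at [v]. Rigidity makes it congruent to [p], so heights and abscissas
    relative to [v] agree up to sign; closeness fixes the signs, and [q] equals [p]. *)
Lemma rigid_full_rank : generic (H := H) X ->
  rigid u phi l A (sym_placement u Q p) -> full_rank T X.
Proof.
move=> gX [x [xP iso]]; apply: contrapT => nT.
have [eps eps0 near_x] := isolated_config_near iso.
have a0 := dot_u_gt0 u_neq0; set a := dot u u in a0.
have /card_gt0P[v0 _] := vert_gt0 G; pose v : cvert H := orbit_of (vact phi) v0.
pose Y (k : K) := if k.2 then X k else X k - X (v, false).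
(* Smaller than every nonzero [|Y k|]; terms with [Y k = 0] contribute 0 to the sum, since the
   inverse of 0 is 0. *)
pose e1 := (1 + \sum_k `|Y k|^-1)^-1.
have S0 : 0 <= \sum_k `|Y k|^-1 by apply: sumr_ge0 => k _; rewrite invr_ge0.
have e1P k : Y k != 0 -> e1 < `|Y k|.
  move=> Yk; rewrite -[ltRHS]invrK ltf_pV2 ?posrE ?invr_gt0 ?normr_gt0 //;
    last by lra.
  rewrite (bigD1 k) //=; have : 0 <= \sum_(i | i != k) `|Y i|^-1.
    by apply: sumr_ge0 => i _; rewrite invr_ge0.
  by lra.
have e10 : 0 < e1 by rewrite invr_gt0; lra.
have a2 : 0 < a + 2 by lra.
(* Frame coordinates at most [e2] give a squared length at most 2 e2^2 / a, which is below eps^2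
   because 2 a < (a + 2)^2. *)
pose e2 := eps * (a / (a + 2)); have e20 : 0 < e2 by rewrite !mulr_gt0 ?invr_gt0.
have [|q [Xq [k0 k0q] qv Bq]] := generic_flexible (e := Num.min e1 e2) v gX nT.
  by rewrite lt_min e10.
have [p' p'q] := frame_coords_surj u_neq0 (Q := Q) q.
have rz : realizations u phi l A (sym_placement u Q p').
  apply/realizationsP => //; split; first exact: sym_placement_equivariant.
  by move=> f fT; rewrite restriction_sym_placement // p'q Bq.
have [z zP] := realization_val rz.
have /asboolP[h hC zx] : congruent x z.
  apply: near_x => i; have [g iE] := vertex_rep Q i; set w := orbit_of _ _ in iE.
  rewrite xP zP iE !sym_placementE.
  set D := _ - _; have Db b : frame u D b ^+ 2 <= e2 ^+ 2.
    have -> : frame u D b ^+ 2 = (q (w, b) - X (w, b)) ^+ 2.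
      rewrite /D frameB !frame_gact // -p'q /frame_coords /=.
      case: b; last by rewrite !mul1r.
      by rewrite -mulrBr exprMn [sgn R g ^+ 2]expr2 sgn_sqr mul1r.
    have := Xq (w, b); rewrite le_min => /andP[_].
    by rewrite (normr_le_sqr _ (ltW e20)).
  have DD : dot D D * a < eps ^+ 2 * a.
    rewrite dot_frame; apply: (@le_lt_trans _ _ (2 * e2 ^+ 2)).
      by have := Db true; have := Db false; lra.
    rewrite /e2 exprMn mulrCA ltr_pM2l ?exprn_gt0 // expr_div_n mulrA.
    rewrite ltr_pdivrMr ?exprn_gt0 // !expr2.
    by have := mulr_gt0 a0 (mulr_gt0 a0 a0); have := mulr_gt0 a0 a0; lra.
  have {}DD : dot D D < eps ^+ 2 by move: DD; rewrite ltr_pM2r.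
  rewrite -[`|D|]/(mx_norm D).
  have [->|/mx_norm_neq0[[i0 j0] /= ->]] := eqVneq (mx_norm D) 0; first by [].
  rewrite (ord1 i0) (normr_lt_sqr _ (ltW eps0));
    exact: le_lt_trans (sqr_entry_le _ _) DD.
have qE w b : q (w, b) = frame u (h (p w)) b.
  rewrite -p'q /frame_coords /= -{1}(restriction_sym_placement u Q p') /restriction.
  by rewrite -zP zx xP -[sym_placement u Q p _]/(restriction Q (sym_placement u Q
    p) w) restriction_sym_placement.
have small k : Y k != 0 -> `|q k - X k| < `|Y k|.
  by move=> /e1P; have := Xq k; rewrite le_min => /andP[+ _]; exact: le_lt_trans.
have opp_case (c c' : R) : c' ^+ 2 = c ^+ 2 -> (c != 0 -> `|c' - c| < `|c|) -> c'
  = c.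
  move=> /eqP; rewrite eqf_sqr => /orP[/eqP //|/eqP -> lt].
  apply/eqP; rewrite -subr_eq0; apply: contraT => cc.
  have c0 : c != 0 by apply: contraNneq cc => ->; rewrite oppr0 addr0.
  have := lt c0; rewrite -opprD normrN (_ : c + c = 2 * c); last by lra.
  have c1 : (0 : R) < Num.norm c by rewrite normr_gt0.
  by rewrite normrM (@gtr0_norm _ 2) //; lra.
have height w : q (w, true) = X (w, true).
  apply: opp_case; last exact: (small (w, true)).
  by rewrite qE Cent_height.
case/eqP: k0q; case: k0 => w [|]; first exact: height.
have := Cent_dist (p w) (p v) hC; rewrite -!qE qv !height.
move=> /addIr /opp_case hx.
suff /addIr : q (w, false) - X (v, false) = X (w, false) - X (v, false) by [].
apply: hx => Y0; have := small (w, false) Y0.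
by rewrite /Y /= opprB addrA subrK.
Qed.

End RigidityCriterion.

Theorem theorem2 (R : realType) (u : 'rV[R]_2) (u_neq0 : u != 0)
    (G : multigraph) (phi : free_action G) (Q : colored_quotient phi) :
  exists Z : set (qplacement R phi),
    [/\ algebraic_subset Z,
        Z <> setT
      & forall p : qplacement R phi, ~ Z p ->
          exists l : edge G -> R,
            [/\ forall e, 0 < l e,
                realizations u phi l [set: edge G]%SET (sym_placement u Q p)
              & minimally_rigid u phi l (sym_placement u Q p)
                <-> reflection_laman (quotient_graph Q)]].
Proof.
have [F FE] := polyfun_mpoly u (polyfun_gram_product R (quotient_graph Q)).
exists [set p | forall f, [set F] f -> mpoly.meval (coords p) f = 0]; split.
- by exists [set F].
- have [q q0] := gram_product_neq0 R (quotient_graph Q).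
  have [p pq] := frame_coords_surj u_neq0 q.
  move=> /(congr1 (fun Z => Z p)) /= ZT.
  have := FE p; rewrite pq (_ : mpoly.meval _ _ = 0) => [/esym/eqP|].
    by rewrite (negPf q0).
  by have : True by []; rewrite -[True]ZT; apply.
move=> p Zp; have gp : generic (H := quotient_graph Q) (frame_coords (Q := Q) u p).
  apply: gram_product_generic; rewrite -FE; apply/eqP => F0; apply: Zp => /= f ->.
  exact: F0.
exists (induced_length u Q p); split.
- by move=> e; exact: induced_length_gt0.
- rewrite -(edges_over_setT Q); exact: sym_placement_realization.
have n0 : (0 < #|cvert (quotient_graph Q)|)%N.
  have /card_gt0P[v _] := vert_gt0 G.
  by apply/card_gt0P; exists (orbit_of (vact phi) v).
(* Removing an orbit of edges deletes one edge of the quotient, and genericity of [p] concerns all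
   edge subsets, so the rigidity criterion applies before and after the removal. *)
rewrite -(generic_minimal n0 gp) /minimally_rigid -(edges_over_setT Q).
split=> -[rigT flexT]; split.
- exact: (rigid_full_rank u_neq0 gp rigT).
- move=> f; have [e <-] := orbit_witness Q f => /(full_rank_rigid u_neq0).
  by rewrite edges_over_setC; exact: flexT.
- exact: full_rank_rigid.
- move=> e; rewrite -(edges_over_setC Q) => /(rigid_full_rank u_neq0 gp).
  exact: flexT.
Qed.
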